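(* Let $\Omega\subset\mathbb{R}^2$ be a bounded strictly convex domain with smooth boundary $\partial\Omega$, let $\mu>0$ be a constant, and let $v$ be a solution of $$\mathrm{div}\left(\frac{\nabla v}{\sqrt{1+|\nabla v|^2}}\right)=\frac{1}{\sqrt{1+|\nabla v|^2}}+\mu\ \text{ in }\Omega,\qquad v=0\ \text{ on }\partial\Omega.$$ Put $q_{\min}=\min_{\partial\Omega}|\nabla v|$, $v_{\min}=\min_{\overline{\Omega}}v$ and $\kappa_{\max}=\max_{\partial\Omega}\kappa$, where $\kappa$ is the curvature of $\partial\Omega$. Then $$q_{\min}\geq\frac{1+\mu}{2\kappa_{\max}}$$ and $$-v_{\min}\geq 2\ln\left(\frac{(1+\mu)\sqrt{1+\frac{(1+\mu)^2}{4\kappa_{\max}^2}}}{1+\mu\sqrt{1+\frac{(1+\mu)^2}{4\kappa_{\max}^2}}}\right).$$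
   Context: The curvature $\kappa$ of $\partial\Omega$, as a planar curve, is computed with respect to the inward orientation, and strict convexity of $\Omega$ means $\kappa>0$ on $\partial\Omega$. Solutions are understood as classical solutions, smooth on $\overline{\Omega}$. *)

(* Defs.v *)
From Stdlib Require Import Reals.
From Coquelicot Require Import Coquelicot.
Open Scope R_scope.

Definition R2 : Type := (R * R)%type.

Definition is_minimum (E : R -> Prop) (m : R) : Prop :=
  E m /\ forall x, E x -> m <= x.

Definition is_maximum (E : R -> Prop) (m : R) : Prop :=
  E m /\ forall x, E x -> x <= m.

(* [ball] on [R * R] is Coquelicot's product ball, i.e. an open square; it
   induces the usual topology of the plane. *)
Definition closure (A : R2 -> Prop) (p : R2) : Prop :=
  forall eps : posreal, exists q : R2, ball p eps q /\ A q.

Definition boundary (A : R2 -> Prop) (p : R2) : Prop :=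
  closure A p /\ closure (fun q => ~ A q) p.

Definition is_bounded (A : R2 -> Prop) : Prop :=
  exists M : R, forall p : R2, A p -> norm p <= M.

Definition connected (A : R2 -> Prop) : Prop :=
  forall U V : R2 -> Prop, open U -> open V ->
    (forall p, A p -> U p \/ V p) ->
    (exists p, A p /\ U p) -> (exists p, A p /\ V p) ->
    exists p, A p /\ U p /\ V p.

Definition is_domain (Omega : R2 -> Prop) : Prop :=
  (exists p, Omega p) /\ open Omega /\ connected Omega.

Definition convex (A : R2 -> Prop) : Prop :=
  forall (p q : R2) (t : R), A p -> A q -> 0 <= t <= 1 ->
    A ((1 - t) * fst p + t * fst q, (1 - t) * snd p + t * snd q).

(* Near each boundary point, in the direct orthonormal frame [(a, b)],
   [(- b, a)] centred at that point, [Omega] is the strict epigraph of a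
   smooth function of one variable. *)
Definition smooth_boundary (Omega : R2 -> Prop) : Prop :=
  forall p : R2, boundary Omega p ->
    exists (a b : R) (phi : R -> R) (r : posreal),
      a ^ 2 + b ^ 2 = 1 /\ phi 0 = 0 /\
      (forall s, Rabs s < r -> forall n, ex_derive_n phi n s) /\
      (forall s t, Rabs s < r -> Rabs t < r ->
         Omega (fst p + s * a - t * b, snd p + s * b + t * a) <-> phi s < t).

(* Signed curvature of a regular plane curve with respect to its left normal. *)
Definition curve_curvature (g1 g2 : R -> R) (t : R) : R :=
  (Derive g1 t * Derive_n g2 2 t - Derive g2 t * Derive_n g1 2 t) /
  (sqrt (Derive g1 t ^ 2 + Derive g2 t ^ 2)) ^ 3.

(* [k] is the curvature at [p] of the boundary of [Omega]: it is computed along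
   a smooth regular local parametrization [(g1, g2)] of the boundary with
   [(g1 0, g2 0) = p], traversed so that the left normal [(- g2', g1')] at [p]
   points into [Omega]. The value does not depend on the parametrization. *)
Definition boundary_curvature (Omega : R2 -> Prop) (p : R2) (k : R) : Prop :=
  exists g1 g2 : R -> R,
    (g1 0, g2 0) = p /\
    locally 0 (fun t => boundary Omega (g1 t, g2 t)) /\
    locally 0 (fun t => forall n, ex_derive_n g1 n t /\ ex_derive_n g2 n t) /\
    (Derive g1 0, Derive g2 0) <> (0, 0) /\
    (exists eps : posreal, forall t, 0 < t < eps ->
       Omega (g1 0 - t * Derive g2 0, g2 0 + t * Derive g1 0)) /\
    k = curve_curvature g1 g2 0.

Definition strictly_convex (Omega : R2 -> Prop) : Prop :=
  convex Omega /\
  forall (p : R2) (k : R), boundary_curvature Omega p k -> 0 < k.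

Definition dx (f : R -> R -> R) (x y : R) : R := Derive (fun s => f s y) x.
Definition dy (f : R -> R -> R) (x y : R) : R := Derive (fun s => f x s) y.

Definition grad_norm (f : R -> R -> R) (x y : R) : R :=
  sqrt (dx f x y ^ 2 + dy f x y ^ 2).

Definition divergence (F1 F2 : R -> R -> R) (x y : R) : R :=
  dx F1 x y + dy F2 x y.

(* [f] is C^infinity on an open neighbourhood of [K]. The values of [f] away
   from that neighbourhood are irrelevant, so for [K] the closure of a smooth
   domain this is smoothness up to the boundary, with derivatives at boundary
   points equal to the limits of those taken inside. *)
Definition smooth_on (K : R2 -> Prop) (f : R -> R -> R) : Prop :=
  exists U : R2 -> Prop,
    open U /\ (forall p, K p -> U p) /\
    (forall p, U p -> forall n, ex_diff_n f n (fst p) (snd p)).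

Definition slope_factor (v : R -> R -> R) (x y : R) : R :=
  sqrt (1 + grad_norm v x y ^ 2).

Definition is_solution (Omega : R2 -> Prop) (mu : R) (v : R -> R -> R) : Prop :=
  smooth_on (closure Omega) v /\
  (forall x y, Omega (x, y) ->
     divergence (fun x y => dx v x y / slope_factor v x y)
                (fun x y => dy v x y / slope_factor v x y) x y
     = 1 / slope_factor v x y + mu) /\
  (forall x y, boundary Omega (x, y) -> v x y = 0).

(* Main.v *)
Require Import Defs.
From Stdlib Require Import Reals Psatz ClassicalEpsilon.
From Coquelicot Require Import Coquelicot.
Open Scope R_scope.

(** Both inequalities come from comparing [v] with one explicit paraboloid.

    Put [K = (1 + mu) / 2]. On a disc of centre [c] and radius [rho] contained
    in [Omega], let [w(z) = k/2 (|z - c|^2 - rho^2)] with [0 < k < K]. Written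
    out, the equation says that the Hessian of [v], paired with the positive
    matrix [(1 + |p|^2) I - p p^T] where [p] is the gradient, equals
    [(1 + |p|^2) (1 + mu sqrt (1 + |p|^2))]. For [w] the pairing is only
    [k (2 + |p|^2) <= 2 k (1 + |p|^2)], which is strictly smaller, so [v - w]
    has no interior local maximum ([paraboloid_touching]). As [v <= 0] in
    [Omega] (the case [k = 0]) and [w = 0] on the circle, [v <= w] on the disc
    ([below_paraboloid]).

    If moreover the circle passes through a boundary point [P], where
    [v = w = 0], then comparing the derivatives along the inner normal gives
    [|grad v (P)| >= k rho], while at the centre [v <= - k rho^2 / 2]
    ([barrier_estimates]). Letting [k] tend to [K] and [rho] to
    [1 / kappa_max] gives the bound on [q_min] and
    [- v_min >= (1 + mu) / (4 kappa_max^2)]; the latter is stronger than the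
    logarithmic bound, because [2 ln z <= z^2 - 1] ([log_bound]).

    It remains to find the disc: this is Blaschke's rolling theorem
    ([rolling_disc]), in a convex domain with curvature less than [1 / rho] a
    disc of radius [rho] tangent from inside at any boundary point stays in
    the domain. Its infinitesimal content is that a boundary point
    near which the domain is enclosed in a disc of radius [rho] has curvature
    at least [1 / rho] ([curvature_lower_bound]). For directions at an acute
    angle with the normal at the contact point, an enclosing disc is found by
    translating the tangent disc until it last meets the domain
    ([reaches_acute]). Larger angles are reached by changing the contact point
    to one whose normal is the bisector ([reaches_double]). *)

(** * Compactness and convexity in the plane *)

Lemma pos_below (a b : R) : 0 < a -> 0 < b -> exists h, 0 < h /\ h < a /\ h < b.
Proof.
  intros Ha Hb. exists (Rmin a b / 2).
  assert (H1 := Rmin_l a b). assert (H2 := Rmin_r a b).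
  assert (H3 := Rmin_glb_lt a b 0 Ha Hb). lra.
Qed.

Lemma sum_squares_le_0 (a b : R) : a ^ 2 + b ^ 2 <= 0 -> a = 0 /\ b = 0.
Proof.
  intros H. assert (Ha := pow2_ge_0 a). assert (Hb := pow2_ge_0 b).
  split; apply Rsqr_0_uniq; unfold Rsqr; lra.
Qed.

Lemma convex_comb_lt (a b e t : R) :
  a < e -> b < e -> 0 <= t <= 1 -> (1 - t) * a + t * b < e.
Proof.
  intros Ha Hb Ht.
  destruct (Rle_lt_dec t (1 / 2)) as [H | H].
  - assert (0 < (1 - t) * (e - a)) by (apply Rmult_lt_0_compat; lra).
    assert (0 <= t * (e - b)) by (apply Rmult_le_pos; lra). lra.
  - assert (0 <= (1 - t) * (e - a)) by (apply Rmult_le_pos; lra).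
    assert (0 < t * (e - b)) by (apply Rmult_lt_0_compat; lra). lra.
Qed.

Lemma unit_coords_bound (a b : R) : a ^ 2 + b ^ 2 = 1 -> Rabs a <= 1 /\ Rabs b <= 1.
Proof. intros H. split; apply Rabs_le; nra. Qed.

Lemma unit_dot_lt (a b u v e : R) :
  a ^ 2 + b ^ 2 = 1 -> Rabs u < e -> Rabs v < e -> Rabs (u * a + v * b) < 2 * e.
Proof.
  intros H Hu Hv. destruct (unit_coords_bound a b H) as [Ha Hb].
  assert (H1 := Rabs_triang (u * a) (v * b)). rewrite !Rabs_mult in H1.
  assert (Rabs u * Rabs a <= Rabs u * 1)
    by (apply Rmult_le_compat_l; [apply Rabs_pos | lra]).
  assert (Rabs v * Rabs b <= Rabs v * 1)
    by (apply Rmult_le_compat_l; [apply Rabs_pos | lra]).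
  lra.
Qed.

Lemma closure_coords (A : R2 -> Prop) (x y : R) :
  closure A (x, y) <->
  forall eps, 0 < eps -> exists x' y',
    Rabs (x' - x) < eps /\ Rabs (y' - y) < eps /\ A (x', y').
Proof.
  split; intros H eps.
  - intros Heps. destruct (H (mkposreal eps Heps)) as [[x' y'] [[H1 H2] HA]].
    exists x', y'. now repeat split.
  - destruct (H eps (cond_pos eps)) as [x' [y' [H1 [H2 HA]]]].
    exists (x', y'). now repeat split.
Qed.

Lemma closure_incl (A : R2 -> Prop) (p : R2) : A p -> closure A p.
Proof. intros HA eps. exists p. split; [apply ball_center | exact HA]. Qed.

Lemma closure_closure (A : R2 -> Prop) (p : R2) :
  closure (closure A) p -> closure A p.
Proof.
  intros H eps.
  assert (Hh : 0 < eps / 2) by (destruct eps; simpl; lra).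
  destruct (H (mkposreal _ Hh)) as [q [Hq HA]].
  destruct (HA (mkposreal _ Hh)) as [q' [Hq' HA']].
  exists q'. split; [| exact HA'].
  replace (pos eps) with (eps / 2 + eps / 2) by field.
  exact (ball_triangle p q q' _ _ Hq Hq').
Qed.

Lemma closure_not_mem_boundary (A : R2 -> Prop) (p : R2) :
  closure A p -> ~ A p -> boundary A p.
Proof. intros H1 H2. split; [exact H1 | now apply closure_incl]. Qed.

Lemma open_coords (A : R2 -> Prop) (x y : R) :
  open A -> A (x, y) -> exists eps, 0 < eps /\
    forall x' y', Rabs (x' - x) < eps -> Rabs (y' - y) < eps -> A (x', y').
Proof.
  intros HA Hxy. destruct (HA _ Hxy) as [eps Heps].
  exists eps. split; [apply cond_pos |].
  intros x' y' H1 H2. apply Heps. now split.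
Qed.

Lemma closure_bounded (A : R2 -> Prop) :
  is_bounded A -> exists M, forall x y,
    closure A (x, y) -> Rabs x <= M /\ Rabs y <= M.
Proof.
  intros [M HM]. exists (M + 1). intros x y Hxy.
  destruct (proj1 (closure_coords _ _ _) Hxy 1 Rlt_0_1)
    as [x' [y' [Hx [Hy HA]]]].
  assert (HN := HM _ HA).
  assert (HR := proj1 (@norm_prod R_AbsRing R_NormedModule R_NormedModule x' y')).
  change (Rmax (Rabs x') (Rabs y') <= norm ((x', y') : R2)) in HR.
  assert (H1 := Rmax_l (Rabs x') (Rabs y')).
  assert (H2 := Rmax_r (Rabs x') (Rabs y')).
  assert (H3 := Rabs_triang_inv x x'). assert (H4 := Rabs_triang_inv y y').
  rewrite (Rabs_minus_sym x x') in H3. rewrite (Rabs_minus_sym y y') in H4.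
  lra.
Qed.

Lemma closure_convex (A : R2 -> Prop) : convex A -> convex (closure A).
Proof.
  intros HA [x1 y1] [x2 y2] t H1 H2 Ht. simpl.
  apply closure_coords. intros eps Heps.
  destruct (proj1 (closure_coords _ _ _) H1 eps Heps)
    as [x1' [y1' [Hx1 [Hy1 HA1]]]].
  destruct (proj1 (closure_coords _ _ _) H2 eps Heps)
    as [x2' [y2' [Hx2 [Hy2 HA2]]]].
  exists ((1 - t) * x1' + t * x2'), ((1 - t) * y1' + t * y2').
  assert (Hc : forall a b a' b', Rabs (a' - a) < eps -> Rabs (b' - b) < eps ->
            Rabs ((1 - t) * a' + t * b' - ((1 - t) * a + t * b)) < eps).
  { intros a b a' b' Ha Hb.
    apply Rabs_lt_between in Ha, Hb. apply Rabs_lt_between.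
    assert (H3 := convex_comb_lt (a' - a) (b' - b) eps t).
    assert (H4 := convex_comb_lt (a - a') (b - b') eps t). lra. }
  split; [| split]; [now apply Hc | now apply Hc |].
  exact (HA (x1', y1') (x2', y2') t HA1 HA2 Ht).
Qed.

Lemma closure_sublevel (K : R2 -> Prop) (f : R -> R -> R) (ga x y : R) :
  (forall x' y', K (x', y') -> f x' y' <= ga) -> continuity_2d_pt f x y ->
  closure K (x, y) -> f x y <= ga.
Proof.
  intros HK Hf Hc. apply Rnot_lt_le. intros Hlt.
  assert (Hgap : 0 < f x y - ga) by lra.
  destruct (Hf (mkposreal _ Hgap)) as [d Hd].
  destruct (proj1 (closure_coords _ _ _) Hc d (cond_pos d)) as [x' [y' [Hx [Hy HKxy]]]].
  specialize (Hd x' y' Hx Hy). specialize (HK x' y' HKxy). simpl in Hd.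
  apply Rabs_lt_between in Hd. lra.
Qed.

Lemma continuity_2d_pt_affine (al be ga x y : R) :
  continuity_2d_pt (fun u v => al * u + be * v + ga) x y.
Proof.
  apply continuity_2d_pt_plus; [| apply continuity_2d_pt_const].
  apply continuity_2d_pt_plus;
    (apply continuity_2d_pt_mult; [apply continuity_2d_pt_const |]).
  - apply continuity_2d_pt_id1.
  - apply continuity_2d_pt_id2.
Qed.

Lemma closure_affine_le (K : R2 -> Prop) (al be ga x y : R) :
  (forall x' y', K (x', y') -> al * x' + be * y' <= ga) ->
  closure K (x, y) -> al * x + be * y <= ga.
Proof.
  intros HK Hc.
  enough (al * x + be * y + 0 <= ga) by lra.
  apply (closure_sublevel K (fun u w => al * u + be * w + 0)); [| | exact Hc].
  - intros x' y' H. rewrite Rplus_0_r. auto.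
  - apply continuity_2d_pt_affine.
Qed.

Lemma continuity_2d_pt_dist_sq (c1 c2 x y : R) :
  continuity_2d_pt (fun u w => (u - c1) ^ 2 + (w - c2) ^ 2) x y.
Proof.
  apply continuity_2d_pt_ext
    with (fun u w => (u - c1) * (u - c1) + (w - c2) * (w - c2)); [intros; ring |].
  apply continuity_2d_pt_plus; apply continuity_2d_pt_mult;
    (apply continuity_2d_pt_minus; [| apply continuity_2d_pt_const]);
    apply continuity_2d_pt_id1 || apply continuity_2d_pt_id2.
Qed.

(** Without a minimum, every point [t] of the enclosing square has a
    neighbourhood on which [f] exceeds, along [K], some value [f] takes on [K].
    Finitely many such neighbourhoods cover the square, and the smallest of
    their values is attained at a point of [K] where [f] would exceed itself. *)
Lemma min_on_compact (K : R2 -> Prop) (M : R) (f : R -> R -> R) :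
  (forall p, closure K p -> K p) ->
  (forall x y, K (x, y) -> Rabs x <= M /\ Rabs y <= M) ->
  (exists p, K p) ->
  (forall x y, K (x, y) -> continuity_2d_pt f x y) ->
  exists x y, K (x, y) /\ forall x' y', K (x', y') -> f x y <= f x' y'.
Proof.
  intros Hcl Hbd [[x0 y0] H0] Hf. apply NNPP. intros Hno.
  assert (Hlow : forall x y, K (x, y) ->
            exists x' y', K (x', y') /\ f x' y' < f x y).
  { intros x y Hxy. apply NNPP. intros Hn. apply Hno. exists x, y.
    split; [exact Hxy |]. intros x' y' H'.
    destruct (Rle_or_lt (f x y) (f x' y')) as [H | H]; [exact H |].
    exfalso. apply Hn. now exists x', y'. }
  assert (Hloc : forall p : R2, exists q : posreal * R,
    (exists x y, K (x, y) /\ f x y = snd q) /\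
    forall x y, K (x, y) -> Rabs (x - fst p) < fst q ->
      Rabs (y - snd p) < fst q -> snd q < f x y).
  { intros [x y]. destruct (classic (K (x, y))) as [HK | HK].
    - destruct (Hlow x y HK) as [x1 [y1 [HK1 Hlt]]].
      assert (Hd : 0 < f x y - f x1 y1) by lra.
      destruct (Hf x y HK (mkposreal _ Hd)) as [d Hdd].
      exists (d, f x1 y1). split; [now exists x1, y1 |]. simpl.
      intros x' y' _ Hx' Hy'. specialize (Hdd x' y' Hx' Hy'). simpl in Hdd.
      apply Rabs_lt_between in Hdd. lra.
    - assert (Hc : ~ closure K (x, y)) by (intros H; apply HK, Hcl, H).
      rewrite closure_coords in Hc. apply not_all_ex_not in Hc.
      destruct Hc as [d Hd]. apply imply_to_and in Hd. destruct Hd as [Hd Hn].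
      exists (mkposreal d Hd, f x0 y0). split; [now exists x0, y0 |]. simpl.
      intros x' y' HK' Hx' Hy'. exfalso. apply Hn. now exists x', y'. }
  pose (q := fun p => proj1_sig (constructive_indefinite_description _ (Hloc p))).
  assert (Hq : forall p,
    (exists x y, K (x, y) /\ f x y = snd (q p)) /\
    forall x y, K (x, y) -> Rabs (x - fst p) < fst (q p) ->
      Rabs (y - snd p) < fst (q p) -> snd (q p) < f x y).
  { intros p. unfold q. apply proj2_sig. }
  clearbody q.
  pose (flat := fun t : Compactness.Tn 2 R => (fst t, fst (snd t)) : R2).
  apply (compactness_list 2 (- M, (- M, tt)) (M, (M, tt))
           (fun t => fst (q (flat t)))).
  intros [l Hl].
  assert (Hmin : exists x y, K (x, y) /\
            forall t, List.In t l -> f x y <= snd (q (flat t))).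
  { clear Hl. induction l as [| t l IH].
    - exists x0, y0. split; [exact H0 | intros t []].
    - destruct IH as [x [y [HK Hle]]].
      destruct (proj1 (Hq (flat t))) as [x1 [y1 [HK1 He]]].
      destruct (Rle_or_lt (f x y) (f x1 y1)) as [Hc | Hc].
      + exists x, y. split; [exact HK |]. intros t' [<- | Ht']; [lra | auto].
      + exists x1, y1. split; [exact HK1 |]. intros t' [<- | Ht']; [lra |].
        specialize (Hle t' Ht'). lra. }
  destruct Hmin as [x [y [HK Hle]]].
  destruct (Hbd x y HK) as [Hx Hy]. apply Rabs_le_between in Hx, Hy.
  destruct (Hl (x, (y, tt))) as [[t1 [t2 t3]] [Hin [_ Hclose]]].
  { simpl. repeat split; lra. }
  simpl in Hclose. destruct Hclose as [Hc1 [Hc2 _]].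
  assert (H1 := proj2 (Hq (t1, t2)) x y HK Hc1 Hc2).
  specialize (Hle _ Hin). unfold flat in Hle. simpl in Hle. lra.
Qed.

Lemma support_point Omega m1 m2 :
  is_bounded Omega -> (exists p, Omega p) ->
  exists x y, closure Omega (x, y) /\ forall x' y', closure Omega (x', y') ->
    (x' - x) * m1 + (y' - y) * m2 <= 0.
Proof.
  intros Hbd [p Hp]. destruct (closure_bounded Omega Hbd) as [M HM].
  destruct (min_on_compact (closure Omega) M (fun x y => - m1 * x + - m2 * y + 0))
    as [x [y [HZ Hmin]]].
  - apply closure_closure.
  - exact HM.
  - exists p. now apply closure_incl.
  - intros x y _. apply continuity_2d_pt_affine.
  - exists x, y. split; [exact HZ |]. intros x' y' HZ'. specialize (Hmin _ _ HZ').
    cbv beta in Hmin. lra.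
Qed.

(** The normal [e] points from the nearest point of [Z] towards [p]: a point
    of [Z] on the wrong side of it would, by convexity, give closer points. *)
Lemma projection_separates (Z : R2 -> Prop) (M px py : R) :
  convex Z -> (forall p, closure Z p -> Z p) ->
  (forall x y, Z (x, y) -> Rabs x <= M /\ Rabs y <= M) ->
  (exists p, Z p) -> ~ Z (px, py) ->
  exists e1 e2 x0 y0, e1 ^ 2 + e2 ^ 2 = 1 /\
    0 < (px - x0) * e1 + (py - y0) * e2 /\
    forall x y, Z (x, y) -> (x - x0) * e1 + (y - y0) * e2 <= 0.
Proof.
  intros Hconv Hcl Hbd Hne Hp.
  destruct (min_on_compact Z M (fun x y => (x - px) ^ 2 + (y - py) ^ 2))
    as [x0 [y0 [HZ Hmin]]]; [exact Hcl | exact Hbd | exact Hne |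
     intros x y _; apply continuity_2d_pt_dist_sq |].
  pose (D2 := (px - x0) ^ 2 + (py - y0) ^ 2).
  assert (HD2 : 0 < D2).
  { destruct (Rle_lt_dec D2 0) as [H | H]; [| exact H]. exfalso. apply Hp.
    apply sum_squares_le_0 in H.
    replace px with x0 by lra. replace py with y0 by lra. exact HZ. }
  set (D := sqrt D2). assert (HD : 0 < D) by (now apply sqrt_lt_R0).
  assert (HDD : D ^ 2 = D2) by (apply pow2_sqrt; lra).
  exists ((px - x0) / D), ((py - y0) / D), x0, y0. split; [| split].
  - transitivity (D2 / D ^ 2); [unfold D2; field; lra | rewrite HDD; field; lra].
  - replace ((px - x0) * ((px - x0) / D) + (py - y0) * ((py - y0) / D)) with (D2 / D)
      by (unfold D2; field; lra).
    now apply Rdiv_lt_0_compat.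
  - intros x y Hxy.
    pose (al := (x - x0) * (px - x0) + (y - y0) * (py - y0)).
    pose (be := (x - x0) ^ 2 + (y - y0) ^ 2).
    assert (Hbe : 0 <= be) by (apply Rplus_le_le_0_compat; apply pow2_ge_0).
    replace ((x - x0) * ((px - x0) / D) + (y - y0) * ((py - y0) / D)) with (al / D)
      by (unfold al; field; lra).
    apply Rnot_lt_le. intros Hpos.
    assert (Hal : 0 < al).
    { replace al with (al / D * D) by (field; lra). now apply Rmult_lt_0_compat. }
    assert (Hq : 0 < al / (be + 1)) by (apply Rdiv_lt_0_compat; lra).
    destruct (pos_below 1 (al / (be + 1)) Rlt_0_1 Hq) as [l [Hl0 [Hl1 Hl2]]].
    assert (Hlb : l * be <= al).
    { assert (l * (be + 1) <= al / (be + 1) * (be + 1)) by (apply Rmult_le_compat_r; lra).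
      replace (al / (be + 1) * (be + 1)) with al in H by (field; lra). lra. }
    assert (Hm := Hmin _ _ (Hconv (x0, y0) (x, y) l HZ Hxy ltac:(lra))).
    cbn [fst snd] in Hm.
    replace (((1 - l) * x0 + l * x - px) ^ 2 + ((1 - l) * y0 + l * y - py) ^ 2)
      with (D2 - 2 * (l * al) + l * (l * be)) in Hm by (unfold D2, al, be; ring).
    replace ((x0 - px) ^ 2 + (y0 - py) ^ 2) with D2 in Hm
      by (unfold D2; ring).
    assert (l * (l * be) <= l * al) by (apply Rmult_le_compat_l; lra).
    assert (0 < l * al) by (now apply Rmult_lt_0_compat). lra.
Qed.

(** * One-variable calculus *)

Lemma derive_positive_right (f : R -> R) (l : R) :
  is_derive f 0 l -> 0 < l ->
  exists d, 0 < d /\ forall s, 0 < s < d -> f 0 < f s.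
Proof.
  intros Hl Hpos. apply is_derive_Reals in Hl.
  destruct (Hl l Hpos) as [d Hd]. exists d. split; [apply cond_pos |].
  intros s Hs. assert (Hn : s <> 0) by lra.
  specialize (Hd s Hn). rewrite Rabs_pos_eq in Hd by lra.
  specialize (Hd (proj2 Hs)). rewrite Rplus_0_l in Hd.
  apply Rabs_lt_between in Hd.
  assert (0 < (f s - f 0) / s * s) by (apply Rmult_lt_0_compat; lra).
  replace ((f s - f 0) / s * s) with (f s - f 0) in H by (now field). lra.
Qed.

Lemma derive_local_min (f : R -> R) (l e : R) :
  is_derive f 0 l -> 0 < e -> (forall s, Rabs s < e -> f 0 <= f s) -> l = 0.
Proof.
  intros Hl He Hmin. destruct (Rtotal_order l 0) as [H | [H | H]]; [| exact H |].
  - destruct (derive_positive_right (fun s => - f s) (- l)) as [d [Hd Hs]].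
    { apply (is_derive_opp f 0 l Hl). } { lra. }
    destruct (pos_below d e Hd He) as [h [Hh [Hhd Hhe]]].
    specialize (Hs h (conj Hh Hhd)). specialize (Hmin h). rewrite Rabs_pos_eq in Hmin by lra. lra.
  - destruct (derive_positive_right (fun s => - f (- s)) l) as [d [Hd Hs]].
    { evar_last. { apply (is_derive_opp (fun s => f (- s))).
        apply (is_derive_comp f (fun s => - s)).
        - rewrite Ropp_0. exact Hl.
        - auto_derive; [trivial | reflexivity]. }
      unfold scal, opp; simpl. unfold mult; simpl. ring. } { lra. }
    destruct (pos_below d e Hd He) as [h [Hh [Hhd Hhe]]].
    specialize (Hs h (conj Hh Hhd)). rewrite Ropp_0 in Hs.
    specialize (Hmin (- h)).
    rewrite Rabs_Ropp, Rabs_pos_eq in Hmin by lra. lra.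
Qed.

Lemma second_order_positive (f f' : R -> R) (l : R) :
  locally 0 (fun s => is_derive f s (f' s)) -> f' 0 = 0 ->
  is_derive f' 0 l -> 0 < l ->
  exists d, 0 < d /\ forall s, 0 < Rabs s < d -> f 0 < f s.
Proof.
  intros [e He] H0 Hl Hpos.
  apply is_derive_Reals in Hl.
  destruct (Hl l Hpos) as [d Hd].
  exists (Rmin d e). split; [apply Rmin_glb_lt; apply cond_pos |].
  intros s [Hs1 Hs2].
  assert (Hsd := Rlt_le_trans _ _ _ Hs2 (Rmin_l _ _)).
  assert (Hse := Rlt_le_trans _ _ _ Hs2 (Rmin_r _ _)).
  assert (Hsgn : forall c, c <> 0 -> Rabs c < d -> 0 < f' c / c).
  { intros c Hc Hcd. specialize (Hd c Hc Hcd).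
    rewrite Rplus_0_l, H0, Rminus_0_r in Hd.
    apply Rabs_lt_between in Hd. lra. }
  assert (Hder : forall c, Rabs c <= Rabs s -> is_derive f c (f' c)).
  { intros c Hc. apply He. change (Rabs (c - 0) < e). rewrite Rminus_0_r. lra. }
  assert (Hlt : forall a b, a < b -> (forall c, a < c < b -> 0 < f' c) ->
            (forall c, a <= c <= b -> Rabs c <= Rabs s) -> f a < f b).
  { intros a b Hab Hp Hr.
    destruct (MVT_cor2 f f' a b Hab) as [c [Hc1 Hc2]].
    { intros c Hc. apply is_derive_Reals. auto. }
    specialize (Hp c Hc2). nra. }
  assert (Hlt' : forall a b, a < b -> (forall c, a < c < b -> f' c < 0) ->
            (forall c, a <= c <= b -> Rabs c <= Rabs s) -> f b < f a).
  { intros a b Hab Hp Hr.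
    destruct (MVT_cor2 f f' a b Hab) as [c [Hc1 Hc2]].
    { intros c Hc. apply is_derive_Reals. auto. }
    specialize (Hp c Hc2). nra. }
  destruct (Rlt_or_le 0 s) as [Hs | Hs].
  - rewrite (Rabs_pos_eq s) in * by lra. apply Hlt; [exact Hs | |].
    + intros c Hc. assert (0 < f' c / c).
      { apply Hsgn; [lra |]. rewrite Rabs_pos_eq; lra. }
      replace (f' c) with (f' c / c * c) by (field; lra). nra.
    + intros c Hc. rewrite Rabs_pos_eq; lra.
  - rewrite (Rabs_left1 s) in * by lra. apply Hlt'; [lra | |].
    + intros c Hc. assert (0 < f' c / c).
      { apply Hsgn; [lra |]. rewrite Rabs_left1; lra. }
      replace (f' c) with (f' c / c * c) by (field; lra). nra.
    + intros c Hc. rewrite Rabs_left1; lra.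
Qed.

(** * The boundary as a local epigraph *)

(** The data that [smooth_boundary] provides at [(x, y)]: [(s, t)] are the
    coordinates in the frame [(a, b)], [(- b, a)]. *)
Definition epigraph_at (Omega : R2 -> Prop) (x y a b : R) (phi : R -> R)
    (r : posreal) : Prop :=
  a ^ 2 + b ^ 2 = 1 /\ phi 0 = 0 /\
  (forall s, Rabs s < r -> forall n, ex_derive_n phi n s) /\
  (forall s t, Rabs s < r -> Rabs t < r ->
     Omega (x + s * a - t * b, y + s * b + t * a) <-> phi s < t).

Lemma epigraph_continuous Omega x y a b phi r s eps :
  epigraph_at Omega x y a b phi r -> Rabs s < r -> 0 < eps ->
  exists d, 0 < d /\ forall s', Rabs (s' - s) < d -> Rabs (phi s' - phi s) < eps.
Proof.
  intros [_ [_ [Hsm _]]] Hs Heps.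
  assert (Hc : continuous phi s) by (apply (ex_derive_continuous phi), (Hsm s Hs 1%nat)).
  destruct (proj1 (filterlim_locally phi (phi s)) Hc (mkposreal eps Heps)) as [d Hd].
  exists d. split; [apply cond_pos |]. intros s' Hs'. exact (Hd s' Hs').
Qed.

Lemma epigraph_closure Omega x y a b phi r s t :
  epigraph_at Omega x y a b phi r -> Rabs s < r -> Rabs t < r ->
  closure Omega (x + s * a - t * b, y + s * b + t * a) -> phi s <= t.
Proof.
  intros HE Hs Ht Hc. apply Rnot_lt_le. intros Hlt.
  destruct (epigraph_continuous _ _ _ _ _ _ _ s ((phi s - t) / 2) HE Hs)
    as [d [Hd Hphi]]; [lra |].
  destruct HE as [Hab [_ [_ Hiff]]].
  pose (m := Rmin (Rmin ((phi s - t) / 2) d) (Rmin (r - Rabs s) (r - Rabs t))).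
  assert (Hm : 0 < m) by (repeat apply Rmin_glb_lt; lra).
  assert (m <= (phi s - t) / 2 /\ m <= d /\ m <= r - Rabs s /\ m <= r - Rabs t)
    as [Hm1 [Hm2 [Hm3 Hm4]]].
  { unfold m. repeat split.
    - eapply Rle_trans; [apply Rmin_l | apply Rmin_l].
    - eapply Rle_trans; [apply Rmin_l | apply Rmin_r].
    - eapply Rle_trans; [apply Rmin_r | apply Rmin_l].
    - eapply Rle_trans; [apply Rmin_r | apply Rmin_r]. }
  clearbody m.
  destruct (proj1 (closure_coords _ _ _) Hc (m / 2)) as [x' [y' [Hx [Hy HO]]]]; [lra |].
  pose (s' := (x' - x) * a + (y' - y) * b).
  pose (t' := (y' - y) * a - (x' - x) * b).
  assert (Hs' : Rabs (s' - s) < m).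
  { replace (s' - s) with
      ((x' - (x + s * a - t * b)) * a + (y' - (y + s * b + t * a)) * b).
    2:{ unfold s'. replace s with (s * (a ^ 2 + b ^ 2)) at 3 by (rewrite Hab; ring). ring. }
    replace m with (2 * (m / 2)) by field. now apply unit_dot_lt. }
  assert (Ht' : Rabs (t' - t) < m).
  { replace (t' - t) with
      ((x' - (x + s * a - t * b)) * (- b) + (y' - (y + s * b + t * a)) * a).
    2:{ unfold t'. replace t with (t * (a ^ 2 + b ^ 2)) at 3 by (rewrite Hab; ring). ring. }
    replace m with (2 * (m / 2)) by field. apply unit_dot_lt; [nra | exact Hx | exact Hy]. }
  assert (Hs'r : Rabs s' < r).
  { assert (H := Rabs_triang (s' - s) s). replace (s' - s + s) with s' in H by ring. lra. }
  assert (Ht'r : Rabs t' < r).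
  { assert (H := Rabs_triang (t' - t) t). replace (t' - t + t) with t' in H by ring. lra. }
  assert (HO' : Omega (x + s' * a - t' * b, y + s' * b + t' * a)).
  { replace (x + s' * a - t' * b) with x'.
    2:{ unfold s', t'. replace x' with (x + (x' - x) * (a ^ 2 + b ^ 2)) at 1
          by (rewrite Hab; ring). ring. }
    replace (y + s' * b + t' * a) with y'; [exact HO |].
    unfold s', t'. replace y' with (y + (y' - y) * (a ^ 2 + b ^ 2)) at 1
      by (rewrite Hab; ring). ring. }
  apply Hiff in HO'; [| exact Hs'r | exact Ht'r].
  assert (Hps := Hphi s' ltac:(lra)).
  apply Rabs_lt_between in Hps, Ht'. lra.
Qed.

Lemma epigraph_graph_boundary Omega x y a b phi r s :
  epigraph_at Omega x y a b phi r -> Rabs s < r -> Rabs (phi s) < r ->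
  boundary Omega (x + s * a - phi s * b, y + s * b + phi s * a).
Proof.
  intros [Hab [_ [_ Hiff]]] Hs Hp. split.
  - apply closure_coords. intros eps Heps.
    destruct (unit_coords_bound a b Hab) as [Ha Hb].
    destruct (pos_below eps (r - Rabs (phi s)) Heps ltac:(lra)) as [m [Hm1 [Hm2 Hm3]]].
    exists (x + s * a - (phi s + m) * b), (y + s * b + (phi s + m) * a).
    split; [| split].
    + replace (x + s * a - (phi s + m) * b - (x + s * a - phi s * b))
        with (- (m * b)) by ring.
      rewrite Rabs_Ropp, Rabs_mult, (Rabs_pos_eq m) by lra. nra.
    + replace (y + s * b + (phi s + m) * a - (y + s * b + phi s * a))
        with (m * a) by ring.
      rewrite Rabs_mult, (Rabs_pos_eq m) by lra. nra.
    + apply Hiff; [exact Hs | | lra].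
      assert (H := Rabs_triang (phi s) m). rewrite (Rabs_pos_eq m) in H; lra.
  - apply closure_incl. intros H. apply Hiff in H; [lra | exact Hs | exact Hp].
Qed.

Lemma epigraph_graph_near_0 Omega x y a b phi r :
  epigraph_at Omega x y a b phi r ->
  exists d, 0 < d /\ forall s, Rabs s < d ->
    boundary Omega (x + s * a - phi s * b, y + s * b + phi s * a).
Proof.
  intros HE. assert (H0 : Rabs 0 < r) by (rewrite Rabs_R0; apply cond_pos).
  destruct (epigraph_continuous _ _ _ _ _ _ _ 0 r HE H0 (cond_pos r)) as [d [Hd Hphi]].
  exists (Rmin d r). split; [apply Rmin_glb_lt; [exact Hd | apply cond_pos] |].
  intros s Hs. assert (H1 := Rmin_l d r). assert (H2 := Rmin_r d r).
  apply (epigraph_graph_boundary _ _ _ _ _ _ r); [exact HE | lra |].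
  specialize (Hphi s). rewrite Rminus_0_r in Hphi.
  rewrite (proj1 (proj2 HE)), Rminus_0_r in Hphi. apply Hphi. lra.
Qed.

Lemma epigraph_derive_0 Omega x y a b phi r :
  epigraph_at Omega x y a b phi r -> is_derive phi 0 (Derive phi 0).
Proof.
  intros [_ [_ [Hsm _]]]. apply Derive_correct.
  apply (Hsm 0 ltac:(rewrite Rabs_R0; apply cond_pos) 1%nat).
Qed.

(** The graph is differentiable at [0], so a point strictly below the tangent
    line would make the segment joining it to the origin, which lies in the
    closure, pass strictly below the graph. *)
Lemma epigraph_support Omega x y a b phi r s t :
  convex Omega -> closure Omega (x, y) ->
  epigraph_at Omega x y a b phi r ->
  closure Omega (x + s * a - t * b, y + s * b + t * a) ->
  Derive phi 0 * s <= t.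
Proof.
  intros Hconv HP HE Hz. apply Rnot_lt_le. intros Hlt.
  assert (Hphi := epigraph_derive_0 _ _ _ _ _ _ _ HE).
  destruct (derive_positive_right (fun l => phi (l * s) - l * t) (Derive phi 0 * s - t))
    as [d [Hd Hpos]].
  { evar_last.
    { apply (is_derive_minus (fun l => phi (l * s)) (fun l => l * t)).
      - apply (is_derive_comp phi (fun l => l * s)).
        + rewrite Rmult_0_l. exact Hphi.
        + auto_derive; [trivial | reflexivity].
      - auto_derive; [trivial | reflexivity]. }
    unfold scal, minus, plus, opp; simpl. unfold mult; simpl. ring. }
  { lra. }
  assert (Hr := cond_pos r).
  (* The segment is followed only while it stays in the window of the frame. *)
  pose (M := 1 + Rabs s + Rabs t).
  assert (HM : 0 < M /\ Rabs s < M /\ Rabs t < M /\ 1 <= M).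
  { unfold M. assert (H1 := Rabs_pos s). assert (H2 := Rabs_pos t). lra. }
  destruct HM as [HM [HMs [HMt HM1]]]. clearbody M.
  assert (HrM : 0 < r / M) by (apply Rdiv_lt_0_compat; lra).
  destruct (pos_below d (r / M) Hd HrM) as [l0 [Hl0 [Hl0d Hl0r]]].
  destruct (pos_below l0 1 Hl0 Rlt_0_1) as [l [Hl [Hll Hl1]]].
  assert (HlM : l * M < r).
  { replace (pos r) with (r / M * M) by (field; lra). apply Rmult_lt_compat_r; lra. }
  specialize (Hpos l ltac:(lra)). cbv beta in Hpos.
  rewrite !Rmult_0_l, (proj1 (proj2 HE)) in Hpos.
  assert (phi (l * s) <= l * t); [| lra].
  assert (Habs : forall u, Rabs u < M -> Rabs (l * u) < r).
  { intros u Hu. rewrite Rabs_mult, (Rabs_pos_eq l) by lra. nra. }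
  apply (epigraph_closure _ _ _ _ _ _ _ _ _ HE); [now apply Habs | now apply Habs |].
  assert (Hseg := closure_convex _ Hconv (x, y) _ l HP Hz ltac:(lra)). simpl in Hseg.
  replace (x + l * s * a - l * t * b)
    with ((1 - l) * x + l * (x + s * a - t * b)) by ring.
  replace (y + l * s * b + l * t * a)
    with ((1 - l) * y + l * (y + s * b + t * a)) by ring.
  exact Hseg.
Qed.

(** The inner normal of the tangent line to the graph. *)
Lemma boundary_support Omega x y :
  convex Omega -> smooth_boundary Omega -> boundary Omega (x, y) ->
  exists n1 n2, n1 ^ 2 + n2 ^ 2 = 1 /\
    forall x' y', closure Omega (x', y') -> 0 <= (x' - x) * n1 + (y' - y) * n2.
Proof.
  intros Hconv Hsm HP. destruct (Hsm _ HP) as [a [b [phi [r HE]]]].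
  change (epigraph_at Omega x y a b phi r) in HE.
  set (m := Derive phi 0).
  assert (HN : 0 < sqrt (1 + m ^ 2)) by (apply sqrt_lt_R0; nra).
  assert (HN2 : sqrt (1 + m ^ 2) ^ 2 = 1 + m ^ 2) by (apply pow2_sqrt; nra).
  set (N := sqrt (1 + m ^ 2)) in *.
  assert (Hab := proj1 HE).
  exists ((- m * a - b) / N), ((- m * b + a) / N). split.
  - transitivity ((1 + m ^ 2) * (a ^ 2 + b ^ 2) / N ^ 2); [field; lra |].
    rewrite Hab, HN2. field. nra.
  - intros x' y' Hz.
    pose (s := (x' - x) * a + (y' - y) * b).
    pose (t := (y' - y) * a - (x' - x) * b).
    assert (Hle : m * s <= t).
    { apply (epigraph_support Omega x y a b phi r); [exact Hconv | exact (proj1 HP) | exact HE |].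
      replace (x + s * a - t * b) with x'.
      2:{ unfold s, t. replace x' with (x + (x' - x) * (a ^ 2 + b ^ 2)) at 1
            by (rewrite Hab; ring). ring. }
      replace (y + s * b + t * a) with y'; [exact Hz |].
      unfold s, t. replace y' with (y + (y' - y) * (a ^ 2 + b ^ 2)) at 1
        by (rewrite Hab; ring). ring. }
    replace ((x' - x) * ((- m * a - b) / N) + (y' - y) * ((- m * b + a) / N))
      with ((t - m * s) / N) by (unfold s, t; field; lra).
    apply Rdiv_le_0_compat; lra.
Qed.

(** * Curvature of the boundary *)

(** Both coordinates of the natural parametrization of the boundary by [s]
    have this form. *)
Lemma is_derive_n_affine_comb (phi : R -> R) (r c a k : R) :
  (forall s, Rabs s < r -> forall n, ex_derive_n phi n s) ->
  forall n s, Rabs s < r ->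
    is_derive (Derive_n (fun s => c + s * a + k * phi s) n) s
      (match n with O => a | _ => 0 end + k * Derive_n phi (S n) s).
Proof.
  intros Hsm n. induction n as [| n IH]; intros s Hs.
  - assert (H := Derive_correct phi s (Hsm s Hs 1%nat)). simpl.
    evar_last.
    { apply (is_derive_plus (fun s => c + s * a) (fun s => k * phi s)).
      - auto_derive; [trivial | reflexivity].
      - apply (is_derive_scal phi), H. }
    unfold plus; simpl. change (fun x : R => phi x) with phi. ring.
  - apply (is_derive_ext_loc
      (fun s => match n with O => a | _ => 0 end + k * Derive_n phi (S n) s)).
    + assert (Hd : 0 < r - Rabs s) by lra.
      assert (Hball : forall u, Rabs (u - s) < r - Rabs s -> Rabs u < r).
      { intros u Hu. assert (H := Rabs_triang (u - s) s).
        replace (u - s + s) with u in H by ring. lra. }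
      exists (mkposreal _ Hd). intros s' Hs'.
      symmetry. apply is_derive_unique, IH.
      apply (Hball s' Hs').
    + assert (H := Derive_correct _ s (Hsm s Hs (S (S n)))).
      apply (is_derive_plus (fun _ => match n with O => a | _ => 0 end)
               (fun s => k * Derive_n phi (S n) s)).
      * apply is_derive_Reals, derivable_pt_lim_const.
      * apply (is_derive_scal (Derive_n phi (S n))), H.
Qed.

(** The parametrization is [s |-> (s, phi s)] in the frame; its left normal at
    [0] is [(- phi' 0, 1)], which points into the epigraph. *)
Lemma epigraph_curvature Omega x y a b phi r :
  epigraph_at Omega x y a b phi r ->
  boundary_curvature Omega (x, y)
    (Derive_n phi 2 0 / sqrt (1 + Derive phi 0 ^ 2) ^ 3).
Proof.
  intros HE. assert (Hphi := epigraph_derive_0 _ _ _ _ _ _ _ HE).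
  assert (Hab := proj1 HE). assert (Hphi0 := proj1 (proj2 HE)).
  assert (Hsm := proj1 (proj2 (proj2 HE))).
  assert (Hr := cond_pos r). set (m := Derive phi 0) in *.
  pose (g1 := fun s => x + s * a + (- b) * phi s).
  pose (g2 := fun s => y + s * b + a * phi s).
  assert (H0 : Rabs 0 < r) by (rewrite Rabs_R0; exact Hr).
  assert (Hg1 : Derive g1 0 = a - b * m).
  { apply is_derive_unique. evar_last.
    - apply (is_derive_n_affine_comb phi r x a (- b) Hsm 0 0 H0).
    - change (a + - b * m = a - b * m). ring. }
  assert (Hg2 : Derive g2 0 = b + a * m).
  { apply is_derive_unique. evar_last.
    - apply (is_derive_n_affine_comb phi r y b a Hsm 0 0 H0).
    - reflexivity. }
  assert (Hg12 : Derive_n g1 2 0 = - b * Derive_n phi 2 0).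
  { apply is_derive_unique. evar_last.
    - apply (is_derive_n_affine_comb phi r x a (- b) Hsm 1 0 H0).
    - apply Rplus_0_l. }
  assert (Hg22 : Derive_n g2 2 0 = a * Derive_n phi 2 0).
  { apply is_derive_unique. evar_last.
    - apply (is_derive_n_affine_comb phi r y b a Hsm 1 0 H0).
    - apply Rplus_0_l. }
  exists g1, g2. rewrite Hg1, Hg2.
  assert (Hg10 : g1 0 = x) by (unfold g1; rewrite Hphi0; ring).
  assert (Hg20 : g2 0 = y) by (unfold g2; rewrite Hphi0; ring).
  rewrite Hg10, Hg20.
  split; [reflexivity |]. split; [| split; [| split; [| split]]].
  - destruct (epigraph_graph_near_0 _ _ _ _ _ _ _ HE) as [d [Hd Hb]].
    exists (mkposreal d Hd). intros s Hs.
    change (Rabs (s - 0) < d) in Hs. rewrite Rminus_0_r in Hs.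
    specialize (Hb s Hs). unfold g1, g2.
    replace (x + s * a + - b * phi s) with (x + s * a - phi s * b) by ring.
    replace (y + s * b + a * phi s) with (y + s * b + phi s * a) by ring.
    exact Hb.
  - exists r. intros s Hs n.
    change (Rabs (s - 0) < r) in Hs. rewrite Rminus_0_r in Hs.
    destruct n as [| n]; [split; exact I |]. split.
    + eexists. apply (is_derive_n_affine_comb phi r x a (- b) Hsm n s Hs).
    + eexists. apply (is_derive_n_affine_comb phi r y b a Hsm n s Hs).
  - intros H. injection H as H1 H2.
    assert (H3 : (a - b * m) ^ 2 + (b + a * m) ^ 2 = (1 + m ^ 2) * (a ^ 2 + b ^ 2)) by ring.
    rewrite Hab, H1, H2 in H3. nra.
  - destruct (derive_positive_right (fun t => t - phi (- m * t)) (1 + m ^ 2))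
      as [d [Hd Hpos]].
    { evar_last.
      { apply (is_derive_minus (fun t => t) (fun t => phi (- m * t))).
        - apply is_derive_id.
        - apply (is_derive_comp phi (fun t => - m * t)).
          + rewrite Rmult_0_r. exact Hphi.
          + auto_derive; [trivial | reflexivity]. }
      unfold scal, minus, plus, opp, one; simpl. unfold mult; simpl. fold m. ring. }
    { nra. }
    pose (M := 1 + Rabs m).
    assert (HM : 1 <= M) by (unfold M; assert (H := Rabs_pos m); lra).
    assert (HrM : 0 < r / M) by (apply Rdiv_lt_0_compat; lra).
    assert (He : 0 < Rmin d (r / M)) by (now apply Rmin_glb_lt).
    exists (mkposreal _ He). simpl. intros t Ht.
    assert (Hl1 := Rmin_l d (r / M)). assert (Hl2 := Rmin_r d (r / M)).
    assert (HtM : t * M < r).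
    { assert (H : t * M < r / M * M) by (apply Rmult_lt_compat_r; lra).
      replace (r / M * M) with (pos r) in H by (field; lra). exact H. }
    specialize (Hpos t ltac:(lra)). cbv beta in Hpos.
    rewrite Rmult_0_r, Hphi0 in Hpos.
    replace (x - t * (b + a * m)) with (x + (- m * t) * a - t * b) by ring.
    replace (y + t * (a - b * m)) with (y + (- m * t) * b + t * a) by ring.
    apply (proj2 (proj2 (proj2 HE))).
    + rewrite Rabs_mult, Rabs_Ropp, (Rabs_pos_eq t) by lra. unfold M in HtM. nra.
    + rewrite Rabs_pos_eq by lra. nra.
    + lra.
  - unfold curve_curvature. rewrite Hg1, Hg2, Hg12, Hg22.
    replace ((a - b * m) ^ 2 + (b + a * m) ^ 2) with ((1 + m ^ 2) * (a ^ 2 + b ^ 2)) by ring.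
    rewrite Hab, Rmult_1_r.
    replace ((a - b * m) * (a * Derive_n phi 2 0) - (b + a * m) * (- b * Derive_n phi 2 0))
      with (Derive_n phi 2 0 * (a ^ 2 + b ^ 2)) by ring.
    rewrite Hab, Rmult_1_r. reflexivity.
Qed.

(** The one-sided form, where only the points of the side [t] are assumed to
    lie in the disc of radius [rho] with inner normal [n], serves a contact
    point at an end of the arc under consideration. The supporting condition
    on both sides forces the tangent of the graph to be orthogonal to [n]. If
    the curvature were smaller than [1 / rho], the function
    [|g(s) - P|^2 - 2 rho <g(s) - P, n>] along the boundary curve [g] would
    have a strict minimum [0] at [s = 0], so [g] would leave the disc on both
    sides. *)
Lemma curvature_lower_bound Omega x y n1 n2 t1 t2 rho e :
  open Omega -> smooth_boundary Omega -> closure Omega (x, y) ->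
  n1 ^ 2 + n2 ^ 2 = 1 -> t1 ^ 2 + t2 ^ 2 = 1 -> t1 * n1 + t2 * n2 = 0 ->
  0 < rho -> 0 < e ->
  (forall x' y', closure Omega (x', y') -> Rabs (x' - x) < e -> Rabs (y' - y) < e ->
     0 <= (x' - x) * n1 + (y' - y) * n2 /\
     (0 <= (x' - x) * t1 + (y' - y) * t2 ->
      (x' - x) ^ 2 + (y' - y) ^ 2 <= 2 * rho * ((x' - x) * n1 + (y' - y) * n2))) ->
  exists k, boundary_curvature Omega (x, y) k /\ / rho <= k.
Proof.
  intros Hop Hsm Hcl Hn Ht Htn Hrho He Hloc.
  assert (HnO : ~ Omega (x, y)).
  { intros HO. destruct (open_coords Omega x y Hop HO) as [d [Hd Hball]].
    destruct (pos_below d e Hd He) as [l [Hl [Hld Hle]]].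
    destruct (unit_coords_bound n1 n2 Hn) as [Hn1 Hn2].
    assert (Hs : forall u, Rabs u <= 1 -> Rabs (- l * u) <= l).
    { intros u Hu. rewrite Rabs_mult, Rabs_Ropp, (Rabs_pos_eq l) by lra. nra. }
    assert (H1 := Hs _ Hn1). assert (H2 := Hs _ Hn2).
    destruct (Hloc (x + - l * n1) (y + - l * n2)) as [H _].
    - apply closure_incl, Hball.
      + replace (x + - l * n1 - x) with (- l * n1) by ring. lra.
      + replace (y + - l * n2 - y) with (- l * n2) by ring. lra.
    - replace (x + - l * n1 - x) with (- l * n1) by ring. lra.
    - replace (y + - l * n2 - y) with (- l * n2) by ring. lra.
    - replace ((x + - l * n1 - x) * n1 + (y + - l * n2 - y) * n2)
        with (- l * (n1 ^ 2 + n2 ^ 2)) in H by ring.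
      rewrite Hn in H. lra. }
  destruct (Hsm _ (closure_not_mem_boundary _ _ Hcl HnO)) as [a [b [phi [r HE]]]].
  change (epigraph_at Omega x y a b phi r) in HE.
  assert (Hphi := epigraph_derive_0 _ _ _ _ _ _ _ HE).
  assert (Hcurv := epigraph_curvature _ _ _ _ _ _ _ HE).
  assert (Hab := proj1 HE). assert (Hphi0 := proj1 (proj2 HE)).
  eexists. split; [exact Hcurv |].
  set (m := Derive phi 0) in *.
  pose (nu1 := n1 * a + n2 * b). pose (nu2 := n2 * a - n1 * b).
  pose (tau1 := t1 * a + t2 * b). pose (tau2 := t2 * a - t1 * b).
  assert (Hnu : nu1 ^ 2 + nu2 ^ 2 = 1).
  { unfold nu1, nu2. transitivity ((n1 ^ 2 + n2 ^ 2) * (a ^ 2 + b ^ 2)); [ring |].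
    rewrite Hn, Hab. ring. }
  assert (Htau : tau1 ^ 2 + tau2 ^ 2 = 1).
  { unfold tau1, tau2. transitivity ((t1 ^ 2 + t2 ^ 2) * (a ^ 2 + b ^ 2)); [ring |].
    rewrite Ht, Hab. ring. }
  assert (Htaunu : tau1 * nu1 + tau2 * nu2 = 0).
  { unfold tau1, tau2, nu1, nu2.
    transitivity ((t1 * n1 + t2 * n2) * (a ^ 2 + b ^ 2)); [ring |].
    rewrite Htn. ring. }
  (* From here on everything takes place in the frame [(a, b)], [(- b, a)]. *)
  assert (Hframe : exists d, 0 < d /\ forall s t, Rabs s < d -> Rabs t < d ->
    closure Omega (x + s * a - t * b, y + s * b + t * a) ->
    0 <= s * nu1 + t * nu2 /\
    (0 <= s * tau1 + t * tau2 -> s ^ 2 + t ^ 2 <= 2 * rho * (s * nu1 + t * nu2))).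
  { exists (e / 2). split; [lra |]. intros s t Hs Htt Hz.
    destruct (Hloc _ _ Hz) as [H1 H2].
    - replace (x + s * a - t * b - x) with (s * a + t * (- b)) by ring.
      replace e with (2 * (e / 2)) by field. apply unit_dot_lt; [nra | exact Hs | exact Htt].
    - replace (y + s * b + t * a - y) with (s * b + t * a) by ring.
      replace e with (2 * (e / 2)) by field. apply unit_dot_lt; [nra | exact Hs | exact Htt].
    - replace ((x + s * a - t * b - x) * n1 + (y + s * b + t * a - y) * n2)
        with (s * nu1 + t * nu2) in H1, H2 by (unfold nu1, nu2; ring).
      replace ((x + s * a - t * b - x) * t1 + (y + s * b + t * a - y) * t2)
        with (s * tau1 + t * tau2) in H2 by (unfold tau1, tau2; ring).
      replace ((x + s * a - t * b - x) ^ 2 + (y + s * b + t * a - y) ^ 2)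
        with ((s ^ 2 + t ^ 2) * (a ^ 2 + b ^ 2)) in H2 by ring.
      rewrite Hab, Rmult_1_r in H2. now split. }
  clear Hloc He e. destruct Hframe as [e [He Hloc]].
  assert (H0r : Rabs 0 < r) by (rewrite Rabs_R0; apply cond_pos).
  assert (Hgraph : exists d, 0 < d /\ forall s, Rabs s < d ->
    0 <= s * nu1 + phi s * nu2 /\
    (0 <= s * tau1 + phi s * tau2 ->
     s ^ 2 + phi s ^ 2 <= 2 * rho * (s * nu1 + phi s * nu2))).
  { destruct (epigraph_graph_near_0 _ _ _ _ _ _ _ HE) as [d1 [Hd1 Hb]].
    destruct (epigraph_continuous _ _ _ _ _ _ _ 0 e HE H0r He) as [d2 [Hd2 Hc]].
    exists (Rmin e (Rmin d1 d2)).
    split; [repeat apply Rmin_glb_lt; assumption |]. intros s Hs.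
    assert (H1 := Rmin_l e (Rmin d1 d2)). assert (H2 := Rmin_r e (Rmin d1 d2)).
    assert (H3 := Rmin_l d1 d2). assert (H4 := Rmin_r d1 d2).
    specialize (Hc s). rewrite Rminus_0_r, Hphi0, Rminus_0_r in Hc.
    apply Hloc; [lra | apply Hc; lra | apply (proj1 (Hb s ltac:(lra)))]. }
  destruct Hgraph as [d [Hd Hg]].
  assert (Hnu1 : nu1 + m * nu2 = 0).
  { apply (derive_local_min (fun s => s * nu1 + phi s * nu2) _ d); [| exact Hd |].
    - apply (is_derive_plus (fun s => s * nu1) (fun s => phi s * nu2)).
      + auto_derive; [trivial | ring].
      + apply (is_derive_scal_l phi 0 m nu2 Hphi).
    - intros s Hs. rewrite Rmult_0_l, Hphi0, Rmult_0_l, Rplus_0_l. apply (Hg s Hs). }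
  assert (Hnu2 : 0 < nu2).
  { destruct (pos_below r e (cond_pos r) He) as [t [Ht0 [Htr Hte]]].
    assert (Hz : 0 <= 0 * nu1 + t * nu2).
    { apply Hloc; [rewrite Rabs_R0; lra | rewrite Rabs_pos_eq; lra |].
      apply closure_incl, (proj2 (proj2 (proj2 HE))); [exact H0r | rewrite Rabs_pos_eq; lra |].
      rewrite Hphi0. lra. }
    assert (Hge : 0 <= nu2).
    { apply (Rmult_le_reg_l t); lra. }
    destruct Hge as [Hge | Heq]; [exact Hge |].
    rewrite <- Heq in Hnu1, Hnu. nra. }
  assert (Htau2 : tau2 = m * tau1) by nra.
  assert (Htau1 : (1 + m ^ 2) * tau1 ^ 2 = 1) by nra.
  assert (HN : 0 < sqrt (1 + m ^ 2)) by (apply sqrt_lt_R0; nra).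
  assert (HN2 : sqrt (1 + m ^ 2) ^ 2 = 1 + m ^ 2) by (apply pow2_sqrt; nra).
  set (N := sqrt (1 + m ^ 2)) in *.
  assert (HnuN : nu2 * N = 1).
  { assert (Hsq : (nu2 * N) ^ 2 = 1).
    { rewrite Rpow_mult_distr, HN2. replace nu1 with (- m * nu2) in Hnu by lra. lra. }
    assert (0 < nu2 * N) by (now apply Rmult_lt_0_compat). nra. }
  set (q := Derive_n phi 2 0).
  apply Rnot_lt_le. intros Hlt.
  assert (Hneg : 0 < 2 * (1 + m ^ 2) - 2 * rho * nu2 * q).
  { assert (H : q / N ^ 3 * (rho * N ^ 3) < / rho * (rho * N ^ 3)).
    { apply Rmult_lt_compat_r; [| exact Hlt].
      apply Rmult_lt_0_compat; [exact Hrho | now apply pow_lt]. }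
    replace (q / N ^ 3 * (rho * N ^ 3)) with (rho * q) in H by (field; lra).
    replace (/ rho * (rho * N ^ 3)) with (N * N ^ 2) in H by (field; lra).
    rewrite HN2 in H.
    assert (H' : nu2 * (rho * q) < nu2 * (N * (1 + m ^ 2))) by (apply Rmult_lt_compat_l; lra).
    replace (nu2 * (N * (1 + m ^ 2))) with (nu2 * N * (1 + m ^ 2)) in H' by ring.
    rewrite HnuN in H'. lra. }
  assert (Hsmooth := proj1 (proj2 (proj2 HE))).
  destruct (second_order_positive
    (fun s => s ^ 2 + phi s ^ 2 - 2 * rho * (s * nu1 + phi s * nu2))
    (fun s => 2 * s + 2 * phi s * Derive phi s - 2 * rho * (nu1 + Derive phi s * nu2))
    (2 * (1 + m ^ 2) - 2 * rho * nu2 * q)) as [d1 [Hd1 Hpsi]].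
  { exists r. intros s Hs.
    assert (Hs' : ex_derive phi s).
    { apply (Hsmooth s) with (n := 1%nat).
      change (Rabs (s - 0) < r) in Hs. now rewrite Rminus_0_r in Hs. }
    auto_derive; [tauto | change (Derive (fun x0 : R => phi x0) s) with (Derive phi s); ring]. }
  { rewrite Hphi0. fold m. rewrite Hnu1. ring. }
  { assert (Hd1 : ex_derive phi 0) by (apply (Hsmooth 0 H0r 1%nat)).
    assert (Hd2 : ex_derive (Derive phi) 0) by (apply (Hsmooth 0 H0r 2%nat)).
    evar_last; [apply Derive_correct; auto_derive; tauto | ].
    apply is_derive_unique. auto_derive; [tauto |].
    change (Derive (fun x0 : R => phi x0) 0) with m.
    change (Derive (fun x0 : R => Derive (fun x1 : R => phi x1) x0) 0) with q.
    change (Derive (fun x0 : R => Derive phi x0) 0) with q.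
    change (Derive phi 0) with m. rewrite Hphi0. ring. }
  { exact Hneg. }
  cbv beta in Hpsi. rewrite Hphi0 in Hpsi.
  (* the sign of [s] for which the curve starts on the side of [t] *)
  pose (sg := if Rle_dec 0 tau1 then 1 else -1).
  assert (Hsg : 0 < sg * tau1 /\ (sg = 1 \/ sg = -1)).
  { assert (Hne : tau1 <> 0) by (intros H; rewrite H in Htau1; lra).
    unfold sg. destruct (Rle_dec 0 tau1); split; tauto || lra. }
  clearbody sg. destruct Hsg as [Hsg Hsg1].
  destruct (derive_positive_right
    (fun l => (sg * l) * tau1 + tau2 * phi (sg * l)) (sg * tau1 * (1 + m ^ 2)))
    as [d2 [Hd2 Hu]].
  { evar_last.
    { apply (is_derive_plus (fun l => (sg * l) * tau1) (fun l => tau2 * phi (sg * l))).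
      - auto_derive; [trivial | reflexivity].
      - apply (is_derive_scal (fun l => phi (sg * l))).
        apply (is_derive_comp phi (fun l => sg * l)).
        + rewrite Rmult_0_r. exact Hphi.
        + auto_derive; [trivial | reflexivity]. }
    unfold scal, plus; simpl. unfold mult; simpl. rewrite Htau2. ring. }
  { apply Rmult_lt_0_compat; nra. }
  destruct (pos_below d1 d2 Hd1 Hd2) as [l0 [Hl0 [Hl1 Hl2]]].
  destruct (pos_below d l0 Hd Hl0) as [l [Hl [Hld Hll0]]].
  assert (Habs : Rabs (sg * l) = l).
  { destruct Hsg1; subst sg.
    - rewrite Rmult_1_l. apply Rabs_pos_eq. lra.
    - replace (-1 * l) with (- l) by ring. rewrite Rabs_Ropp. apply Rabs_pos_eq. lra. }
  specialize (Hu l ltac:(lra)). cbv beta in Hu. rewrite Rmult_0_r, Hphi0 in Hu.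
  specialize (Hpsi (sg * l)). rewrite Habs in Hpsi. specialize (Hpsi ltac:(lra)).
  destruct (Hg (sg * l)) as [_ H]; [lra |].
  specialize (H ltac:(lra)). lra.
Qed.

(** * Blaschke's rolling disc *)

(** The unit vector [t] orthogonal to [u] is taken on the side of [e]; the last
    clause is Parseval's identity. *)
Lemma orthonormal_frame (u1 u2 e1 e2 : R) :
  u1 ^ 2 + u2 ^ 2 = 1 ->
  exists t1 t2, t1 ^ 2 + t2 ^ 2 = 1 /\ t1 * u1 + t2 * u2 = 0 /\
    0 <= e1 * t1 + e2 * t2 /\
    forall p q p' q', (p * t1 + q * t2) * (p' * t1 + q' * t2)
      + (p * u1 + q * u2) * (p' * u1 + q' * u2) = p * p' + q * q'.
Proof.
  intros Hu. destruct (Rle_dec 0 (e2 * u1 - e1 * u2)) as [H | H].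
  - exists (- u2), u1. repeat split; try lra.
    intros p q p' q'. transitivity ((p * p' + q * q') * (u1 ^ 2 + u2 ^ 2)); [ring |].
    rewrite Hu. ring.
  - exists u2, (- u1). repeat split; try lra.
    intros p q p' q'. transitivity ((p * p' + q * q') * (u1 ^ 2 + u2 ^ 2)); [ring |].
    rewrite Hu. ring.
Qed.

(** The disc of radius [rho] tangent from inside at a contact point with outer
    normal [u] does not exceed [Z] in the direction [e]: with [c] the centre,
    some point of [Z] is at least as far as [c + rho e] in that direction. *)
Definition reaches (Z : R2 -> Prop) (rho u1 u2 e1 e2 : R) : Prop :=
  forall x y, Z (x, y) ->
    (forall x' y', Z (x', y') -> (x' - x) * u1 + (y' - y) * u2 <= 0) ->
    exists x' y', Z (x', y') /\
      rho * (1 - (u1 * e1 + u2 * e2)) <= (x' - x) * e1 + (y' - y) * e2.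

(** Take coordinates [(S, T)] at the contact point, with [T] along the inner
    normal [- u] and [S] on the side of [e]. If the disc exceeded the domain in
    the direction [e], minimise the height of the domain above the lower
    half-circle, [T + sqrt (rho^2 - S^2)], on the slab between the contact
    point and the abscissa [rho st] of the extreme point of the disc in the
    direction [e]. At that abscissa the height is larger than at the contact
    point, so the minimiser lies before it; there the domain lies locally in a
    vertical translate of the disc, touching its circle, and
    [curvature_lower_bound] contradicts the bound on the curvature. *)
Lemma reaches_acute Omega rho u1 u2 e1 e2 :
  open Omega -> smooth_boundary Omega -> is_bounded Omega -> 0 < rho ->
  (forall p k, boundary_curvature Omega p k -> k < / rho) ->
  u1 ^ 2 + u2 ^ 2 = 1 -> e1 ^ 2 + e2 ^ 2 = 1 -> 0 < u1 * e1 + u2 * e2 ->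
  reaches (closure Omega) rho u1 u2 e1 e2.
Proof.
  intros Hop Hsm Hbd Hrho Hcurv Hu He Hue x y HX Hsup.
  apply NNPP. intros Hno.
  assert (Hgap : forall x' y', closure Omega (x', y') ->
    (x' - x) * e1 + (y' - y) * e2 < rho * (1 - (u1 * e1 + u2 * e2))).
  { intros x' y' HZ. apply Rnot_le_lt. intros H. apply Hno. now exists x', y'. }
  clear Hno.
  destruct (orthonormal_frame u1 u2 e1 e2 Hu) as [t1 [t2 [Ht [Htu [Hs Hpars]]]]].
  set (ct := u1 * e1 + u2 * e2) in *. set (st := e1 * t1 + e2 * t2) in *.
  assert (Hcs : st ^ 2 + ct ^ 2 = 1).
  { generalize (Hpars e1 e2 e1 e2). intros H. unfold st, ct. lra. }
  pose (S := fun x' y' => (x' - x) * t1 + (y' - y) * t2).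
  pose (T := fun x' y' => - ((x' - x) * u1 + (y' - y) * u2)).
  assert (HST : forall x' y', closure Omega (x', y') ->
            st * S x' y' - ct * T x' y' < rho * (1 - ct) /\ 0 <= T x' y').
  { intros x' y' HZ. generalize (Hgap _ _ HZ) (Hsup _ _ HZ)
      (Hpars (x' - x) (y' - y) e1 e2). unfold S, T, st, ct. lra. }
  assert (Hd2 : forall x1 y1 x2 y2,
            (x2 - x1) ^ 2 + (y2 - y1) ^ 2 =
            (S x2 y2 - S x1 y1) ^ 2 + (T x2 y2 - T x1 y1) ^ 2).
  { intros x1 y1 x2 y2. generalize (Hpars (x2 - x1) (y2 - y1) (x2 - x1) (y2 - y1)).
    unfold S, T. lra. }
  assert (HSn : forall x1 y1 x2 y2 e, Rabs (x2 - x1) < e -> Rabs (y2 - y1) < e ->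
            Rabs (S x2 y2 - S x1 y1) < 2 * e).
  { intros x1 y1 x2 y2 e H1 H2.
    replace (S x2 y2 - S x1 y1) with ((x2 - x1) * t1 + (y2 - y1) * t2)
      by (unfold S; ring). now apply unit_dot_lt. }
  assert (HTn : forall x1 y1 x2 y2 e, Rabs (x2 - x1) < e -> Rabs (y2 - y1) < e ->
            Rabs (T x2 y2 - T x1 y1) < 2 * e).
  { intros x1 y1 x2 y2 e H1 H2.
    replace (T x2 y2 - T x1 y1) with ((x2 - x1) * (- u1) + (y2 - y1) * (- u2))
      by (unfold T; ring). apply unit_dot_lt; [lra | exact H1 | exact H2]. }
  assert (HSX : S x y = 0) by (unfold S; ring).
  assert (HTX : T x y = 0) by (unfold T; ring).
  destruct (closure_bounded Omega Hbd) as [M HM].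
  pose (K := fun p : R2 => closure Omega p /\ 0 <= S (fst p) (snd p) <= rho * st).
  destruct (min_on_compact K M
    (fun x' y' => T x' y' + sqrt (rho ^ 2 - S x' y' ^ 2))) as [xm [ym [HK Hmin]]].
  { intros [x' y'] Hc. split; [| split; simpl].
    - apply closure_closure. intros eps. destruct (Hc eps) as [q [Hq [HK _]]].
      now exists q.
    - enough (- t1 * x' + - t2 * y' <= - t1 * x + - t2 * y) by (unfold S; lra).
      apply (closure_affine_le K); [| exact Hc].
      intros x'' y'' [_ H]. unfold S in H. simpl in H. lra.
    - enough (t1 * x' + t2 * y' <= t1 * x + t2 * y + rho * st) by (unfold S; lra).
      apply (closure_affine_le K); [| exact Hc].
      intros x'' y'' [_ H]. unfold S in H. simpl in H. lra. }
  { intros x' y' [H _]. now apply HM. }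
  { exists (x, y). split; [exact HX |]. simpl. rewrite HSX.
    split; [lra | apply Rmult_le_pos; lra]. }
  { intros x' y' _. apply continuity_2d_pt_plus.
    - apply continuity_2d_pt_ext with (fun a b => - u1 * a + - u2 * b + (u1 * x + u2 * y)).
      + intros a b. unfold T. ring.
      + apply continuity_2d_pt_affine.
    - apply (continuity_1d_2d_pt_comp sqrt (fun a b => rho ^ 2 - S a b ^ 2)).
      + apply continuity_pt_filterlim, continuous_sqrt.
      + apply continuity_2d_pt_minus; [apply continuity_2d_pt_const |].
        assert (HcS : continuity_2d_pt S x' y').
        { apply continuity_2d_pt_ext with (fun a b => t1 * a + t2 * b + - (t1 * x + t2 * y)).
          - intros a b. unfold S. ring.
          - apply continuity_2d_pt_affine. }
        apply continuity_2d_pt_ext with (fun a b => S a b * S a b).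
        * intros a b. ring.
        * now apply continuity_2d_pt_mult. }
  destruct HK as [HZm HSm]. simpl in HSm.
  set (sm := S xm ym) in *. set (tm := T xm ym) in *.
  set (w := sqrt (rho ^ 2 - sm ^ 2)) in *.
  assert (Hle : tm + w <= rho).
  { assert (HKX : K (x, y)).
    { split; [exact HX |]. simpl. rewrite HSX. split; [lra | apply Rmult_le_pos; lra]. }
    specialize (Hmin x y HKX). cbv beta in Hmin. rewrite HSX, HTX in Hmin.
    replace (rho ^ 2 - 0 ^ 2) with (rho ^ 2) in Hmin by ring.
    rewrite sqrt_pow2 in Hmin by lra. lra. }
  assert (Hst1 : st < 1) by nra.
  assert (Hsmrho : sm < rho) by nra.
  assert (Hw2 : w ^ 2 = rho ^ 2 - sm ^ 2) by (apply pow2_sqrt; nra).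
  assert (Hw : 0 < w) by (apply sqrt_lt_R0; nra).
  destruct (HST _ _ HZm) as [Hgm Htm]. fold sm tm in Hgm, Htm.
  assert (Hsmlt : sm < rho * st).
  { destruct (proj2 HSm) as [H | H]; [exact H | exfalso].
    assert (Hwc : w = rho * ct).
    { assert (Hw' : w ^ 2 = (rho * ct) ^ 2) by (rewrite Hw2, H; nra).
      assert (0 < rho * ct) by (now apply Rmult_lt_0_compat). nra. }
    rewrite H in Hgm. nra. }
  assert (Hcontra : forall k p, boundary_curvature Omega p k /\ / rho <= k -> False).
  { intros k p [Hk1 Hk2]. specialize (Hcurv p k Hk1). lra. }
  (* The translated disc has centre [(0, tm + w)]; below its centre, minimality
     is the same as lying in it. *)
  assert (Hdisc : forall x' y', K (x', y') -> T x' y' <= tm + w ->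
            S x' y' ^ 2 + (tm + w - T x' y') ^ 2 <= rho ^ 2).
  { intros x' y' HK' HT. assert (H := Hmin x' y' HK'). cbv beta in H.
    assert (HSr : S x' y' ^ 2 <= rho ^ 2).
    { destruct HK' as [_ HSK]. simpl in HSK. nra. }
    assert (Hsq := pow2_sqrt (rho ^ 2 - S x' y' ^ 2) ltac:(lra)).
    assert (Hsp := sqrt_pos (rho ^ 2 - S x' y' ^ 2)).
    fold sm tm w in H. nra. }
  destruct (proj1 HSm) as [Hsm0 | Hsm0].
  - (* [n] is the unit vector from the minimiser to the centre of the translated
       disc, with coordinates [(al, be)]. *)
    pose (al := - sm / rho). pose (be := w / rho).
    assert (Hab : al ^ 2 + be ^ 2 = 1).
    { unfold al, be. transitivity ((sm ^ 2 + w ^ 2) / rho ^ 2); [field; lra |].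
      rewrite Hw2. field. lra. }
    destruct (pos_below sm (rho * st - sm) Hsm0 ltac:(lra)) as [d0 [Hd0 [Hd0s Hd0r]]].
    destruct (pos_below (w / 2) (d0 / 2) ltac:(lra) ltac:(lra)) as [d [Hd [Hdw Hdd0]]].
    assert (Hnn : (al * t1 - be * u1) ^ 2 + (al * t2 - be * u2) ^ 2 = 1).
    { transitivity (al ^ 2 * (t1 ^ 2 + t2 ^ 2) + be ^ 2 * (u1 ^ 2 + u2 ^ 2)
        - 2 * al * be * (t1 * u1 + t2 * u2)); [ring |].
      rewrite Ht, Hu, Htu. lra. }
    destruct (curvature_lower_bound Omega xm ym (al * t1 - be * u1) (al * t2 - be * u2)
      (- (al * t2 - be * u2)) (al * t1 - be * u1) rho d) as [k Hk];
      [exact Hop | exact Hsm | exact HZm | exact Hnn | lra | ring | exact Hrho | lra | |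
       exact (Hcontra _ _ Hk)].
    intros x' y' HZ' Hx' Hy'.
    assert (HS' := HSn _ _ _ _ _ Hx' Hy'). assert (HT' := HTn _ _ _ _ _ Hx' Hy').
    fold sm in HS'. fold tm in HT'. apply Rabs_lt_between in HS', HT'.
    assert (HKd : S x' y' ^ 2 + (tm + w - T x' y') ^ 2 <= rho ^ 2).
    { apply Hdisc; [split; [exact HZ' | simpl; lra] | lra]. }
    assert (Hprod : 2 * rho * ((x' - xm) * (al * t1 - be * u1) + (y' - ym) * (al * t2 - be * u2))
              = 2 * (- sm * (S x' y' - sm) + w * (T x' y' - tm))).
    { unfold sm at 2, tm, al, be. unfold S, T. field. lra. }
    assert (Hsq := Hd2 xm ym x' y'). fold sm tm in Hsq.
    assert (Hmain : (x' - xm) ^ 2 + (y' - ym) ^ 2 <=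
      2 * rho * ((x' - xm) * (al * t1 - be * u1) + (y' - ym) * (al * t2 - be * u2))).
    { rewrite Hprod, Hsq. nra. }
    split; [| intros _; exact Hmain].
    assert (0 <= (x' - xm) ^ 2 + (y' - ym) ^ 2)
      by (apply Rplus_le_le_0_compat; apply pow2_ge_0).
    apply (Rmult_le_reg_l (2 * rho)); lra.
  - (* The minimiser is the contact point itself, where only the side [S >= 0]
       is controlled. *)
    assert (Hwr : w = rho) by nra.
    assert (Htm0 : tm = 0) by lra.
    destruct (pos_below (rho / 2) (rho * st / 2) ltac:(lra) ltac:(lra)) as [d [Hd [Hd1 Hdst]]].
    destruct (curvature_lower_bound Omega x y (- u1) (- u2) t1 t2 rho d) as [k Hk];
      [exact Hop | exact Hsm | exact HX | lra | exact Ht | lra | exact Hrho | lra | |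
       exact (Hcontra _ _ Hk)].
    intros x' y' HZ' Hx' Hy'.
    assert (HS' := HSn _ _ _ _ _ Hx' Hy'). assert (HT' := HTn _ _ _ _ _ Hx' Hy').
    rewrite HSX in HS'. rewrite HTX in HT'. apply Rabs_lt_between in HS', HT'.
    replace ((x' - x) * - u1 + (y' - y) * - u2) with (T x' y') by (unfold T; ring).
    fold (S x' y'). split; [apply (HST _ _ HZ') |]. intros HSp.
    assert (HKd : S x' y' ^ 2 + (tm + w - T x' y') ^ 2 <= rho ^ 2).
    { apply Hdisc; [split; [exact HZ' | simpl; lra] | lra]. }
    rewrite (Hd2 x y x' y'), HSX, HTX. rewrite Htm0, Hwr in HKd. lra.
Qed.

(** Let [m] be the bisector of [u] and [e], and [Q] a point of the domain
    extreme in the direction [m]. The tangent disc at [Q] is the translate of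
    the one at the contact point [X] by a vector [w]. Reaching [m] from [X] gives
    [<w, m> >= 0], and reaching [u] from [Q] gives [<w, u> <= 0]. As [e] is the
    reflection of [u] in [m], [<w, e> >= 0], so the disc at [X] does not go
    beyond the disc at [Q] in the direction [e], which [Q] reaches. *)
Lemma reaches_double Omega rho u1 u2 m1 m2 e1 e2 c :
  is_bounded Omega -> (exists p, Omega p) ->
  0 <= c -> c = u1 * m1 + u2 * m2 -> u1 ^ 2 + u2 ^ 2 = 1 -> m1 ^ 2 + m2 ^ 2 = 1 ->
  e1 = 2 * c * m1 - u1 -> e2 = 2 * c * m2 - u2 ->
  reaches (closure Omega) rho u1 u2 m1 m2 ->
  reaches (closure Omega) rho m1 m2 u1 u2 ->
  reaches (closure Omega) rho m1 m2 e1 e2 ->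
  reaches (closure Omega) rho u1 u2 e1 e2.
Proof.
  intros Hbd Hne Hc Hcum Hu Hm He1 He2 Hum Hmu Hme x y HX Hsup.
  destruct (support_point Omega m1 m2 Hbd Hne) as [xq [yq [HQ HsupQ]]].
  destruct (Hum x y HX Hsup) as [x1 [y1 [HZ1 H1]]].
  destruct (Hmu xq yq HQ HsupQ) as [x2 [y2 [HZ2 H2]]].
  destruct (Hme xq yq HQ HsupQ) as [x3 [y3 [HZ3 H3]]].
  exists x3, y3. split; [exact HZ3 |].
  specialize (HsupQ _ _ HZ1). specialize (Hsup _ _ HZ2).
  rewrite <- Hcum in H1.
  replace (m1 * u1 + m2 * u2) with c in H2 by lra.
  replace (m1 * e1 + m2 * e2) with c in H3.
  2:{ subst e1 e2. transitivity (2 * c * (m1 ^ 2 + m2 ^ 2) - (u1 * m1 + u2 * m2)).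
      - rewrite Hm, <- Hcum. ring. - ring. }
  replace (u1 * e1 + u2 * e2) with (2 * c ^ 2 - 1).
  2:{ subst e1 e2. transitivity (2 * c * (u1 * m1 + u2 * m2) - (u1 ^ 2 + u2 ^ 2)).
      - rewrite Hu, <- Hcum. ring. - ring. }
  assert (Hqm : rho * (1 - c) <= (xq - x) * m1 + (yq - y) * m2) by lra.
  assert (Hqu : (xq - x) * u1 + (yq - y) * u2 <= - (rho * (1 - c))) by lra.
  assert (Hqe : (xq - x) * e1 + (yq - y) * e2 =
            2 * c * ((xq - x) * m1 + (yq - y) * m2) - ((xq - x) * u1 + (yq - y) * u2)).
  { rewrite He1, He2. ring. }
  replace ((x3 - x) * e1 + (y3 - y) * e2) with
    ((x3 - xq) * e1 + (y3 - yq) * e2 + ((xq - x) * e1 + (yq - y) * e2)) by ring.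
  rewrite Hqe.
  assert (2 * c * (rho * (1 - c)) <= 2 * c * ((xq - x) * m1 + (yq - y) * m2))
    by (apply Rmult_le_compat_l; lra).
  lra.
Qed.

(** Bisecting once covers all directions except [e = - u], and a second time
    this last one, whose bisector is orthogonal to [u]. *)
Lemma reaches_all Omega rho u1 u2 e1 e2 :
  open Omega -> (exists p, Omega p) -> smooth_boundary Omega -> is_bounded Omega ->
  0 < rho -> (forall p k, boundary_curvature Omega p k -> k < / rho) ->
  u1 ^ 2 + u2 ^ 2 = 1 -> e1 ^ 2 + e2 ^ 2 = 1 ->
  reaches (closure Omega) rho u1 u2 e1 e2.
Proof.
  intros Hop Hne Hsm Hbd Hrho Hcurv.
  assert (Hwide : forall u1 u2 e1 e2, u1 ^ 2 + u2 ^ 2 = 1 -> e1 ^ 2 + e2 ^ 2 = 1 ->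
            -1 < u1 * e1 + u2 * e2 -> reaches (closure Omega) rho u1 u2 e1 e2).
  { clear u1 u2 e1 e2. intros u1 u2 e1 e2 Hu He Hue.
    set (N := sqrt (2 + 2 * (u1 * e1 + u2 * e2))).
    assert (HN : 0 < N) by (apply sqrt_lt_R0; lra).
    assert (HN2 : N ^ 2 = 2 + 2 * (u1 * e1 + u2 * e2)) by (apply pow2_sqrt; lra).
    assert (Hm : ((u1 + e1) / N) ^ 2 + ((u2 + e2) / N) ^ 2 = 1).
    { transitivity ((u1 ^ 2 + u2 ^ 2 + (e1 ^ 2 + e2 ^ 2) + 2 * (u1 * e1 + u2 * e2)) / N ^ 2);
        [field; lra |].
      rewrite Hu, He, HN2. field. lra. }
    assert (Hcu : N / 2 = u1 * ((u1 + e1) / N) + u2 * ((u2 + e2) / N)).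
    { transitivity ((u1 ^ 2 + u2 ^ 2 + (u1 * e1 + u2 * e2)) / N); [| field; lra].
      rewrite Hu. replace (u1 * e1 + u2 * e2) with (N ^ 2 / 2 - 1) by lra. field. lra. }
    assert (Hce : N / 2 = (u1 + e1) / N * e1 + (u2 + e2) / N * e2).
    { transitivity ((e1 ^ 2 + e2 ^ 2 + (u1 * e1 + u2 * e2)) / N); [| field; lra].
      rewrite He. replace (u1 * e1 + u2 * e2) with (N ^ 2 / 2 - 1) by lra. field. lra. }
    apply (reaches_double Omega rho u1 u2 ((u1 + e1) / N) ((u2 + e2) / N) e1 e2 (N / 2));
      try assumption; try lra; try (field; lra);
      apply reaches_acute; try assumption; lra. }
  intros Hu He.
  destruct (Rlt_or_le (-1) (u1 * e1 + u2 * e2)) as [H | H]; [now apply Hwide |].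
  assert (Hsum : (u1 + e1) ^ 2 + (u2 + e2) ^ 2 <= 0) by lra.
  apply sum_squares_le_0 in Hsum.
  assert (He1 : e1 = - u1) by lra. assert (He2 : e2 = - u2) by lra. subst e1 e2.
  apply (reaches_double Omega rho u1 u2 (- u2) u1 (- u1) (- u2) 0);
    try assumption; try lra; apply Hwide; lra.
Qed.

(** A point of the disc outside the closure would be separated from it by a
    line, against [reaches_all] in the normal direction. A point of the open
    disc on the boundary is impossible as well, since the supporting line there
    would cut the disc. *)
Lemma rolling_disc Omega rho x y :
  open Omega -> (exists p, Omega p) -> smooth_boundary Omega -> is_bounded Omega ->
  convex Omega -> 0 < rho ->
  (forall p k, boundary_curvature Omega p k -> k < / rho) ->
  boundary Omega (x, y) ->
  exists n1 n2, n1 ^ 2 + n2 ^ 2 = 1 /\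
    forall x' y', (x' - (x + rho * n1)) ^ 2 + (y' - (y + rho * n2)) ^ 2 < rho ^ 2 ->
      Omega (x', y').
Proof.
  intros Hop Hne Hsm Hbd Hconv Hrho Hcurv HP.
  destruct (boundary_support Omega x y Hconv Hsm HP) as [n1 [n2 [Hn Hsup]]].
  exists n1, n2. split; [exact Hn |].
  destruct (closure_bounded Omega Hbd) as [M HM].
  assert (Hcl : forall x' y',
    (x' - (x + rho * n1)) ^ 2 + (y' - (y + rho * n2)) ^ 2 < rho ^ 2 ->
    closure Omega (x', y')).
  { intros px py Hp. apply NNPP. intros HnZ.
    destruct (projection_separates (closure Omega) M px py (closure_convex _ Hconv)
      (closure_closure Omega) HM) as [e1 [e2 [x0 [y0 [He [Hpos Hsep]]]]]];
      [destruct Hne as [q Hq]; exists q; now apply closure_incl | exact HnZ |].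
    destruct (reaches_all Omega rho (- n1) (- n2) e1 e2 Hop Hne Hsm Hbd Hrho Hcurv
      ltac:(lra) He x y (proj1 HP)) as [x' [y' [HZ' Hfar]]].
    { intros x' y' HZ'. specialize (Hsup _ _ HZ'). lra. }
    specialize (Hsep _ _ HZ').
    pose (q1 := px - (x + rho * n1)). pose (q2 := py - (y + rho * n2)).
    assert (Hlarge : rho < q1 * e1 + q2 * e2) by (unfold q1, q2; lra).
    assert (Hcs : (q1 * e1 + q2 * e2) ^ 2 + (q1 * e2 - q2 * e1) ^ 2 = q1 ^ 2 + q2 ^ 2).
    { transitivity ((q1 ^ 2 + q2 ^ 2) * (e1 ^ 2 + e2 ^ 2)); [ring | rewrite He; ring]. }
    fold q1 q2 in Hp. assert (Hsq := pow2_ge_0 (q1 * e2 - q2 * e1)).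
    set (z := q1 * e1 + q2 * e2) in *. nra. }
  intros px py Hp. apply NNPP. intros HnO.
  assert (HpB := closure_not_mem_boundary _ _ (Hcl _ _ Hp) HnO).
  destruct (boundary_support Omega px py Hconv Hsm HpB) as [k1 [k2 [Hk Hsupp]]].
  set (c1 := x + rho * n1) in *. set (c2 := y + rho * n2) in *.
  (* A small step against the normal [k] stays in the disc. *)
  set (g := rho ^ 2 - ((px - c1) ^ 2 + (py - c2) ^ 2)).
  assert (Hg : 0 < g) by (unfold g; lra).
  pose (B := 1 + 2 * Rabs ((px - c1) * k1 + (py - c2) * k2)).
  assert (HB : 1 <= B).
  { assert (H := Rabs_pos ((px - c1) * k1 + (py - c2) * k2)). unfold B. lra. }
  assert (HgB : 0 < g / B) by (apply Rdiv_lt_0_compat; lra).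
  destruct (pos_below 1 (g / B) Rlt_0_1 HgB) as [l [Hl0 [Hl1 HlgB]]].
  assert (HlB : l * B < g).
  { replace g with (g / B * B) by (field; lra). apply Rmult_lt_compat_r; lra. }
  specialize (Hsupp (px - l * k1) (py - l * k2)).
  replace ((px - l * k1 - px) * k1 + (py - l * k2 - py) * k2)
    with (- l * (k1 ^ 2 + k2 ^ 2)) in Hsupp by ring.
  rewrite Hk in Hsupp.
  enough (0 <= - l * 1) by lra. apply Hsupp, Hcl.
  replace ((px - l * k1 - c1) ^ 2 + (py - l * k2 - c2) ^ 2)
    with ((px - c1) ^ 2 + (py - c2) ^ 2 - 2 * l * ((px - c1) * k1 + (py - c2) * k2)
          + l ^ 2 * (k1 ^ 2 + k2 ^ 2)) by ring.
  rewrite Hk.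
  assert (Ha := Rle_abs (- ((px - c1) * k1 + (py - c2) * k2))). rewrite Rabs_Ropp in Ha.
  set (dot := (px - c1) * k1 + (py - c2) * k2) in *.
  assert (- (2 * l * dot) + l ^ 2 * 1 <= l * B).
  { unfold B. assert (l * - dot <= l * Rabs dot) by (apply Rmult_le_compat_l; lra). nra. }
  unfold g in HlB. lra.
Qed.

(** * The equation at a point touched from above by a paraboloid *)

Lemma smooth_near (K : R2 -> Prop) (f : R -> R -> R) (x y : R) :
  smooth_on K f -> K (x, y) -> locally_2d (fun u w => forall n, ex_diff_n f n u w) x y.
Proof.
  intros [U [HU [HKU Hf]]] HK.
  destruct (open_coords U x y HU (HKU _ HK)) as [d [Hd Hball]].
  exists (mkposreal d Hd). intros u w Hu Hw. apply (Hf (u, w)). now apply Hball.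
Qed.

Lemma ex_diff_n_differentiable (f : R -> R -> R) (x y : R) :
  locally_2d (fun u w => ex_diff_n f 1 u w) x y ->
  differentiable_pt_lim f x y (dx f x y) (dy f x y).
Proof.
  intros Hloc. apply filterdiff_differentiable_pt_lim.
  apply (is_derive_filterdiff f x y (dx f) (dy f x y)).
  - apply (locally_2d_locally (fun u w => is_derive (fun z => f z w) u (dx f u w)) x y).
    destruct Hloc as [d Hd]. exists d. intros u w Hu Hw.
    apply Derive_correct. apply (Hd u w Hu Hw).
  - apply Derive_correct. apply (locally_2d_singleton _ _ _ Hloc).
  - apply continuity_2d_pt_filterlim.
    apply (locally_2d_singleton _ _ _ Hloc).
Qed.

Lemma is_derive_along_line (f : R -> R -> R) (x y a b s : R) :
  locally_2d (fun u w => ex_diff_n f 1 u w) (x + s * a) (y + s * b) ->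
  is_derive (fun l => f (x + l * a) (y + l * b)) s
    (dx f (x + s * a) (y + s * b) * a + dy f (x + s * a) (y + s * b) * b).
Proof.
  intros Hloc. apply is_derive_Reals.
  apply (derivable_pt_lim_comp_2d f (fun l => x + l * a) (fun l => y + l * b)).
  - now apply ex_diff_n_differentiable.
  - apply is_derive_Reals. auto_derive; [trivial | ring].
  - apply is_derive_Reals. auto_derive; [trivial | ring].
Qed.

Lemma locally_2d_twice (P : R -> R -> Prop) (x y : R) :
  locally_2d P x y -> locally_2d (fun u w => locally_2d P u w) x y.
Proof.
  intros [d Hd]. assert (Hd2 : 0 < d / 2) by (assert (H := cond_pos d); lra).
  exists (mkposreal _ Hd2). simpl. intros u w Hu Hw.
  exists (mkposreal _ Hd2). simpl. intros u' w' Hu' Hw'. apply Hd.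
  - assert (H := Rabs_triang (u' - u) (u - x)).
    replace (u' - u + (u - x)) with (u' - x) in H by ring. lra.
  - assert (H := Rabs_triang (w' - w) (w - y)).
    replace (w' - w + (w - y)) with (w' - y) in H by ring. lra.
Qed.

Lemma locally_2d_along_line (P : R -> R -> Prop) (x y a b : R) :
  locally_2d P x y ->
  exists d, 0 < d /\ forall s, Rabs s < d -> P (x + s * a) (y + s * b).
Proof.
  intros [d Hd]. pose (M := 1 + Rabs a + Rabs b).
  assert (Ha := Rabs_pos a). assert (Hb := Rabs_pos b). assert (Hp := cond_pos d).
  exists (d / M). split; [apply Rdiv_lt_0_compat; unfold M; lra |].
  intros s Hs.
  assert (HsM : Rabs s * M < d).
  { replace (pos d) with (d / M * M) by (unfold M; field; lra).
    apply Rmult_lt_compat_r; unfold M in *; lra. }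
  assert (Hs0 := Rabs_pos s).
  apply Hd.
  - replace (x + s * a - x) with (s * a) by ring. rewrite Rabs_mult. unfold M in HsM. nra.
  - replace (y + s * b - y) with (s * b) by ring. rewrite Rabs_mult. unfold M in HsM. nra.
Qed.

(** The second-derivative test along the line through [(x, y)] with direction
    [(a, b)]; the mixed derivatives enter through their sum. *)
Lemma hessian_at_max (f : R -> R -> R) (k c1 c2 x y a b : R) :
  locally_2d (fun u w => forall n, ex_diff_n f n u w) x y ->
  locally_2d (fun u w => f u w - k / 2 * ((u - c1) ^ 2 + (w - c2) ^ 2) <=
                         f x y - k / 2 * ((x - c1) ^ 2 + (y - c2) ^ 2)) x y ->
  dx (dx f) x y * a ^ 2 + (dy (dx f) x y + dx (dy f) x y) * (a * b) + dy (dy f) x y * b ^ 2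
    <= k * (a ^ 2 + b ^ 2).
Proof.
  intros Hsm Hmax.
  assert (Hdx : locally_2d (fun u w => ex_diff_n (dx f) 1 u w) x y).
  { apply locally_2d_impl with (2 := Hsm). apply locally_2d_forall.
    intros u w H. apply (H 2%nat). }
  assert (Hdy : locally_2d (fun u w => ex_diff_n (dy f) 1 u w) x y).
  { apply locally_2d_impl with (2 := Hsm). apply locally_2d_forall.
    intros u w H. apply (H 2%nat). }
  pose (g := fun s => f (x + s * a) (y + s * b)
                - k / 2 * ((x + s * a - c1) ^ 2 + (y + s * b - c2) ^ 2)).
  pose (g' := fun s => dx f (x + s * a) (y + s * b) * a + dy f (x + s * a) (y + s * b) * b
                - k * ((x + s * a - c1) * a + (y + s * b - c2) * b)).
  set (l := dx (dx f) x y * a ^ 2 + (dy (dx f) x y + dx (dy f) x y) * (a * b)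
            + dy (dy f) x y * b ^ 2).
  assert (Hg : exists d, 0 < d /\ forall s, Rabs s < d -> is_derive g s (g' s)).
  { assert (H1 : locally_2d (fun u w => ex_diff_n f 1 u w) x y).
    { apply locally_2d_impl with (2 := Hsm). apply locally_2d_forall.
      intros u w H. apply (H 1%nat). }
    destruct (locally_2d_along_line _ x y a b (locally_2d_twice _ _ _ H1)) as [d [Hd Hs]].
    exists d. split; [exact Hd |]. intros s Hsd. unfold g, g'.
    apply (is_derive_minus (fun s => f (x + s * a) (y + s * b))
      (fun s => k / 2 * ((x + s * a - c1) ^ 2 + (y + s * b - c2) ^ 2))).
    - apply is_derive_along_line. now apply Hs.
    - auto_derive; [trivial | field]. }
  assert (Hg' : is_derive g' 0 (l - k * (a ^ 2 + b ^ 2))).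
  { evar_last.
    { apply (is_derive_minus
        (fun s => dx f (x + s * a) (y + s * b) * a + dy f (x + s * a) (y + s * b) * b)
        (fun s => k * ((x + s * a - c1) * a + (y + s * b - c2) * b))).
      - apply (is_derive_plus (fun s => dx f (x + s * a) (y + s * b) * a)
                              (fun s => dy f (x + s * a) (y + s * b) * b)).
        + apply (is_derive_ext (fun s => a * dx f (x + s * a) (y + s * b)));
            [intros s; apply Rmult_comm |].
          apply (is_derive_scal (fun s => dx f (x + s * a) (y + s * b))).
          apply is_derive_along_line. rewrite !Rmult_0_l, !Rplus_0_r. exact Hdx.
        + apply (is_derive_ext (fun s => b * dy f (x + s * a) (y + s * b)));
            [intros s; apply Rmult_comm |].
          apply (is_derive_scal (fun s => dy f (x + s * a) (y + s * b))).
          apply is_derive_along_line. rewrite !Rmult_0_l, !Rplus_0_r. exact Hdy.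
      - auto_derive; [trivial | reflexivity]. }
    unfold minus, plus, opp; simpl. rewrite !Rmult_0_l, !Rplus_0_r. unfold l. ring. }
  destruct Hg as [d [Hd Hg]].
  destruct (locally_2d_along_line _ x y a b Hmax) as [d1 [Hd1 Hs1]].
  assert (Hle : forall s, Rabs s < d1 -> g s <= g 0).
  { intros s Hs. specialize (Hs1 s Hs). unfold g.
    rewrite !(Rmult_0_l a), !(Rmult_0_l b), !Rplus_0_r. exact Hs1. }
  assert (Hg0 : g' 0 = 0).
  { enough (- g' 0 = 0) by lra.
    apply (derive_local_min (fun s => - g s) _ d1); [| exact Hd1 |].
    - apply (is_derive_opp g). apply Hg. now rewrite Rabs_R0.
    - intros s Hs. specialize (Hle s Hs). lra. }
  apply Rnot_lt_le. intros Hlt.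
  destruct (second_order_positive g g' (l - k * (a ^ 2 + b ^ 2))) as [d2 [Hd2 Hp]].
  { exists (mkposreal d Hd). intros s Hs. apply Hg.
    change (Rabs (s - 0) < d) in Hs. now rewrite Rminus_0_r in Hs. }
  { exact Hg0. } { exact Hg'. } { lra. }
  destruct (pos_below d1 d2 Hd1 Hd2) as [h [Hh [Hh1 Hh2]]].
  specialize (Hp h). specialize (Hle h).
  rewrite Rabs_pos_eq in Hp, Hle by lra.
  specialize (Hp ltac:(lra)). specialize (Hle ltac:(lra)). lra.
Qed.

Lemma slope_factor_eq (f : R -> R -> R) (x y : R) :
  slope_factor f x y = sqrt (1 + (dx f x y ^ 2 + dy f x y ^ 2)).
Proof.
  unfold slope_factor, grad_norm. rewrite pow2_sqrt; [reflexivity |].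
  apply Rplus_le_le_0_compat; apply pow2_ge_0.
Qed.

(** The derivative of one component of a field [(P, Q)] divided by
    [sqrt (1 + P^2 + Q^2)]; this gives both terms of the divergence. *)
Lemma Derive_normalized (P Q : R -> R) (s P' Q' : R) :
  is_derive P s P' -> is_derive Q s Q' ->
  Derive (fun l => P l / sqrt (1 + (P l ^ 2 + Q l ^ 2))) s =
    (P' * (1 + (P s ^ 2 + Q s ^ 2)) - P s * (P s * P' + Q s * Q'))
      / sqrt (1 + (P s ^ 2 + Q s ^ 2)) ^ 3.
Proof.
  intros HP HQ. apply is_derive_unique.
  assert (Hpos : 0 < 1 + (P s ^ 2 + Q s ^ 2)).
  { assert (H1 := pow2_ge_0 (P s)). assert (H2 := pow2_ge_0 (Q s)). lra. }
  assert (HW := sqrt_lt_R0 _ Hpos). assert (HW2 := pow2_sqrt _ (Rlt_le _ _ Hpos)).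
  evar_last.
  - auto_derive; [| reflexivity].
    repeat split; try (eexists; eassumption).
    + simpl in Hpos. simpl. lra.
    + simpl in HW |- *. lra.
  - rewrite (is_derive_unique (fun x : R => P x) s P' HP).
    rewrite (is_derive_unique (fun x : R => Q x) s Q' HQ).
    change (1 + (P s * (P s * 1) + Q s * (Q s * 1))) with (1 + (P s ^ 2 + Q s ^ 2)).
    set (W := sqrt (1 + (P s ^ 2 + Q s ^ 2))) in *. rewrite <- HW2. field. lra.
Qed.

(** The equation in nondivergence form, multiplied by the cube of the slope
    factor. *)
Lemma equation_expanded (Omega : R2 -> Prop) (mu : R) (v : R -> R -> R) (x y : R) :
  is_solution Omega mu v -> Omega (x, y) ->
  dx (dx v) x y * (1 + dy v x y ^ 2)
    - (dy (dx v) x y + dx (dy v) x y) * (dx v x y * dy v x y)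
    + dy (dy v) x y * (1 + dx v x y ^ 2)
  = (1 + (dx v x y ^ 2 + dy v x y ^ 2)) * (1 + mu * slope_factor v x y).
Proof.
  intros [Hsm [Heq _]] HO.
  assert (Hloc := locally_2d_singleton _ _ _
    (smooth_near _ _ _ _ Hsm (closure_incl _ _ HO)) 2%nat).
  destruct Hloc as [_ [_ [_ [[_ [Hxx [Hxy _]]] [_ [Hyx [Hyy _]]]]]]].
  specialize (Heq x y HO).
  assert (H1 := Derive_normalized (fun s => dx v s y) (fun s => dy v s y) x
    (dx (dx v) x y) (dx (dy v) x y)
    (Derive_correct _ _ Hxx) (Derive_correct _ _ Hyx)).
  assert (H2 := Derive_normalized (fun s => dy v x s) (fun s => dx v x s) y
    (dy (dy v) x y) (dy (dx v) x y)
    (Derive_correct _ _ Hyy) (Derive_correct _ _ Hxy)).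
  cbv beta in H1, H2.
  change (Derive (fun s => dx v s y / slope_factor v s y) x +
          Derive (fun s => dy v x s / slope_factor v x s) y
          = 1 / slope_factor v x y + mu) in Heq.
  rewrite (Derive_ext _ (fun s => dx v s y / sqrt (1 + (dx v s y ^ 2 + dy v s y ^ 2)))) in Heq
    by (intros s; now rewrite slope_factor_eq).
  rewrite (Derive_ext (fun s => dy v x s / slope_factor v x s)
    (fun s => dy v x s / sqrt (1 + (dy v x s ^ 2 + dx v x s ^ 2)))) in Heq
    by (intros s; rewrite slope_factor_eq; do 3 f_equal; apply Rplus_comm).
  rewrite H1, H2 in Heq. rewrite (Rplus_comm (dy v x y ^ 2)) in Heq.
  rewrite slope_factor_eq in Heq |- *.
  set (p := dx v x y) in *. set (q := dy v x y) in *.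
  assert (Hpos : 0 < 1 + (p ^ 2 + q ^ 2)).
  { assert (Hp := pow2_ge_0 p). assert (Hq := pow2_ge_0 q). lra. }
  assert (HW := sqrt_lt_R0 _ Hpos). assert (HW2 := pow2_sqrt _ (Rlt_le _ _ Hpos)).
  set (W := sqrt (1 + (p ^ 2 + q ^ 2))) in *.
  set (vxx := dx (dx v) x y) in *. set (vyx := dx (dy v) x y) in *.
  set (vxy := dy (dx v) x y) in *. set (vyy := dy (dy v) x y) in *.
  apply (f_equal (fun z => z * W ^ 3)) in Heq.
  transitivity (((vxx * (1 + (p ^ 2 + q ^ 2)) - p * (p * vxx + q * vyx)) / W ^ 3 +
    (vyy * (1 + (p ^ 2 + q ^ 2)) - q * (q * vyy + p * vxy)) / W ^ 3) * W ^ 3).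
  - field. lra.
  - rewrite Heq. rewrite <- HW2. field. lra.
Qed.

(** With [p] the gradient and [n] the vector [p] turned by a right angle, the
    matrix of second-order coefficients is [I + n n^T]. So the pairing is the
    sum of the second derivatives in the two coordinate directions and in the
    direction [n], and each is bounded by the Hessian test. *)
Lemma paraboloid_touching (Omega : R2 -> Prop) (mu k c1 c2 x y : R) (v : R -> R -> R) :
  is_solution Omega mu v -> 0 < mu -> 0 <= k -> Omega (x, y) ->
  locally_2d (fun u w => v u w - k / 2 * ((u - c1) ^ 2 + (w - c2) ^ 2) <=
                         v x y - k / 2 * ((x - c1) ^ 2 + (y - c2) ^ 2)) x y ->
  (1 + mu) / 2 <= k.
Proof.
  intros Hv Hmu Hk HO Hmax.
  assert (Heq := equation_expanded _ _ _ _ _ Hv HO).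
  assert (Hsm := smooth_near _ _ _ _ (proj1 Hv) (closure_incl _ _ HO)).
  assert (Hess := fun a b => hessian_at_max v k c1 c2 x y a b Hsm Hmax).
  assert (Hx := Hess 1 0). assert (Hy := Hess 0 1).
  assert (Hxy := Hess (- dy v x y) (dx v x y)). clear Hess.
  assert (HW : 1 <= slope_factor v x y).
  { rewrite slope_factor_eq. rewrite <- sqrt_1 at 1. apply sqrt_le_1_alt.
    assert (H1 := pow2_ge_0 (dx v x y)). assert (H2 := pow2_ge_0 (dy v x y)). lra. }
  set (p := dx v x y) in *. set (q := dy v x y) in *.
  set (W := slope_factor v x y) in *.
  set (vxx := dx (dx v) x y) in *. set (vyx := dx (dy v) x y) in *.
  set (vxy := dy (dx v) x y) in *. set (vyy := dy (dy v) x y) in *.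
  assert (Hg : 0 <= p ^ 2 + q ^ 2) by (apply Rplus_le_le_0_compat; apply pow2_ge_0).
  assert (Hrhs : (1 + (p ^ 2 + q ^ 2)) * (1 + mu) <=
                 (1 + (p ^ 2 + q ^ 2)) * (1 + mu * W)).
  { apply Rmult_le_compat_l; [lra |]. nra. }
  assert (Hlhs : (1 + (p ^ 2 + q ^ 2)) * (1 + mu) <= k * (2 + (p ^ 2 + q ^ 2))) by lra.
  assert (Hkg : 0 <= k * (p ^ 2 + q ^ 2)) by (now apply Rmult_le_pos).
  apply (Rmult_le_reg_l (1 + (p ^ 2 + q ^ 2))); lra.
Qed.

(** * The paraboloid barrier *)

Lemma solution_nonpositive (Omega : R2 -> Prop) (mu : R) (v : R -> R -> R) :
  open Omega -> is_bounded Omega -> (exists p, Omega p) -> 0 < mu ->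
  is_solution Omega mu v -> forall x y, closure Omega (x, y) -> v x y <= 0.
Proof.
  intros Hop Hbd [p0 Hp0] Hmu Hv x y Hxy.
  destruct (closure_bounded Omega Hbd) as [M HM].
  destruct (min_on_compact (closure Omega) M (fun u w => - v u w))
    as [xm [ym [HZ Hmin]]].
  { apply closure_closure. } { exact HM. }
  { exists p0. now apply closure_incl. }
  { intros u w Huw. apply continuity_2d_pt_opp.
    apply (locally_2d_singleton _ _ _ (smooth_near _ _ _ _ (proj1 Hv) Huw) 0%nat). }
  assert (Hxy' := Hmin x y Hxy). cbv beta in Hxy'.
  destruct (classic (Omega (xm, ym))) as [HO | HnO].
  - exfalso. enough ((1 + mu) / 2 <= 0) by lra.
    apply (paraboloid_touching Omega mu 0 0 0 xm ym v Hv Hmu ltac:(lra) HO).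
    destruct (open_coords Omega xm ym Hop HO) as [d [Hd Hball]].
    exists (mkposreal d Hd). intros u w Hu Hw.
    specialize (Hmin u w (closure_incl _ _ (Hball u w Hu Hw))). cbv beta in Hmin. lra.
  - assert (H0 := proj2 (proj2 Hv) _ _ (closure_not_mem_boundary _ _ HZ HnO)). lra.
Qed.

(** The comparison is made on the closure of the open disc rather than on the
    closed disc, so that its points are in the closure of [Omega] by
    monotonicity. At a maximum of [v - w] on the circle [w] vanishes, and
    [v <= 0] concludes. *)
Lemma below_paraboloid (Omega : R2 -> Prop) (mu k rho c1 c2 : R) (v : R -> R -> R) :
  open Omega -> is_bounded Omega -> 0 < mu -> is_solution Omega mu v ->
  0 <= k < (1 + mu) / 2 -> 0 < rho ->
  (forall x y, (x - c1) ^ 2 + (y - c2) ^ 2 < rho ^ 2 -> Omega (x, y)) ->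
  forall x y, closure (fun p => (fst p - c1) ^ 2 + (snd p - c2) ^ 2 < rho ^ 2) (x, y) ->
    v x y <= k / 2 * ((x - c1) ^ 2 + (y - c2) ^ 2 - rho ^ 2).
Proof.
  intros Hop Hbd Hmu Hv Hk Hrho Hdisc x y Hxy.
  set (B := fun p : R2 => (fst p - c1) ^ 2 + (snd p - c2) ^ 2 < rho ^ 2) in *.
  assert (HBO : forall p, B p -> Omega p) by (intros [u w] H; now apply Hdisc).
  assert (Hcl : forall p, closure B p -> closure Omega p).
  { intros p Hp eps. destruct (Hp eps) as [q [Hq HBq]]. exists q. auto. }
  assert (Hsq := continuity_2d_pt_dist_sq c1 c2).
  destruct (closure_bounded Omega Hbd) as [M HM].
  assert (HBc : B (c1, c2)).
  { unfold B. simpl. replace ((c1 - c1) * ((c1 - c1) * 1) + (c2 - c2) * ((c2 - c2) * 1))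
      with 0 by ring. nra. }
  destruct (min_on_compact (closure B) M
    (fun u w => k / 2 * ((u - c1) ^ 2 + (w - c2) ^ 2) - v u w)) as [xm [ym [HZ Hmin]]].
  { apply closure_closure. }
  { intros u w H. apply HM. now apply Hcl. }
  { exists (c1, c2). now apply closure_incl. }
  { intros u w Huw. apply continuity_2d_pt_minus.
    - apply continuity_2d_pt_mult; [apply continuity_2d_pt_const | apply Hsq].
    - apply (locally_2d_singleton _ _ _
        (smooth_near _ _ _ _ (proj1 Hv) (Hcl _ Huw)) 0%nat). }
  assert (Hxy' := Hmin x y Hxy). cbv beta in Hxy'.
  enough (v xm ym <= k / 2 * ((xm - c1) ^ 2 + (ym - c2) ^ 2 - rho ^ 2)) by lra.
  assert (Hin : (xm - c1) ^ 2 + (ym - c2) ^ 2 <= rho ^ 2).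
  { apply (closure_sublevel B (fun u w => (u - c1) ^ 2 + (w - c2) ^ 2));
      [| apply Hsq | exact HZ].
    intros u w H. apply Rlt_le, H. }
  destruct Hin as [Hin | Hon].
  - exfalso. enough ((1 + mu) / 2 <= k) by lra.
    assert (HBm : B (xm, ym)) by exact Hin.
    apply (paraboloid_touching Omega mu k c1 c2 xm ym v Hv Hmu ltac:(lra) (HBO _ HBm)).
    assert (Hgap : 0 < rho ^ 2 - ((xm - c1) ^ 2 + (ym - c2) ^ 2)) by lra.
    destruct (Hsq xm ym (mkposreal _ Hgap)) as [d Hd].
    exists d. intros u w Hu Hw. specialize (Hd u w Hu Hw). simpl pos in Hd.
    apply Rabs_lt_between in Hd.
    assert (HBu : B (u, w)) by (unfold B; simpl fst; simpl snd; lra).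
    specialize (Hmin u w (closure_incl _ _ HBu)). cbv beta in Hmin. lra.
  - rewrite Hon, Rminus_diag, Rmult_0_r.
    apply (solution_nonpositive Omega mu v Hop Hbd); try assumption.
    + exists (c1, c2). now apply HBO.
    + now apply Hcl.
Qed.

Lemma barrier_estimates (Omega : R2 -> Prop) (mu k rho x y : R) (v : R -> R -> R) :
  open Omega -> (exists p, Omega p) -> smooth_boundary Omega -> is_bounded Omega ->
  convex Omega -> 0 < mu -> is_solution Omega mu v ->
  0 < k < (1 + mu) / 2 -> 0 < rho ->
  (forall p c, boundary_curvature Omega p c -> c < / rho) ->
  boundary Omega (x, y) ->
  k * rho <= grad_norm v x y /\
  exists x' y', Omega (x', y') /\ v x' y' <= - (k / 2 * rho ^ 2).
Proof.
  intros Hop Hne Hsm Hbd Hconv Hmu Hv Hk Hrho Hcurv HP.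
  destruct (rolling_disc Omega rho x y Hop Hne Hsm Hbd Hconv Hrho Hcurv HP)
    as [n1 [n2 [Hn Hdisc]]].
  assert (Hbelow := below_paraboloid Omega mu k rho _ _ v Hop Hbd Hmu Hv
    (conj (Rlt_le _ _ (proj1 Hk)) (proj2 Hk)) Hrho Hdisc).
  set (B := fun p : R2 => (fst p - (x + rho * n1)) ^ 2 + (snd p - (y + rho * n2)) ^ 2 < rho ^ 2)
    in *.
  assert (Hray : forall l, 0 < l < 2 * rho -> B (x + l * n1, y + l * n2)).
  { intros l Hl. unfold B. cbn [fst snd].
    replace ((x + l * n1 - (x + rho * n1)) ^ 2 + (y + l * n2 - (y + rho * n2)) ^ 2)
      with ((l - rho) ^ 2 * (n1 ^ 2 + n2 ^ 2)) by ring. rewrite Hn. nra. }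
  split.
  - assert (Hbl : forall l, 0 < l < 2 * rho ->
      v (x + l * n1) (y + l * n2) <= k / 2 * ((l - rho) ^ 2 - rho ^ 2)).
    { intros l Hl. assert (H := Hbelow _ _ (closure_incl _ _ (Hray l Hl))).
      replace ((x + l * n1 - (x + rho * n1)) ^ 2 + (y + l * n2 - (y + rho * n2)) ^ 2)
        with ((l - rho) ^ 2 * (n1 ^ 2 + n2 ^ 2)) in H by ring.
      now rewrite Hn, Rmult_1_r in H. }
    assert (HvP : v x y = 0) by (now apply (proj2 (proj2 Hv))).
    assert (Hder : is_derive (fun l => v (x + l * n1) (y + l * n2)
                       - k / 2 * ((l - rho) ^ 2 - rho ^ 2)) 0
              (dx v x y * n1 + dy v x y * n2 + k * rho)).
    { evar_last.
      { apply (is_derive_minus (fun l => v (x + l * n1) (y + l * n2))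
          (fun l => k / 2 * ((l - rho) ^ 2 - rho ^ 2))).
        - apply is_derive_along_line. rewrite !Rmult_0_l, !Rplus_0_r.
          apply locally_2d_impl with (2 := smooth_near _ _ _ _ (proj1 Hv) (proj1 HP)).
          apply locally_2d_forall. intros u w H. apply (H 1%nat).
        - auto_derive; [trivial | reflexivity]. }
      unfold minus, plus, opp; simpl. rewrite !Rmult_0_l, !Rplus_0_r. field. }
    assert (Hneg : dx v x y * n1 + dy v x y * n2 + k * rho <= 0).
    { apply Rnot_lt_le. intros Hlt.
      destruct (derive_positive_right _ _ Hder Hlt) as [d [Hd Hpos]].
      cbv beta in Hpos. rewrite !Rmult_0_l, !Rplus_0_r, HvP in Hpos.
      destruct (pos_below d rho Hd Hrho) as [h [Hh [Hhd Hhr]]].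
      specialize (Hpos h ltac:(lra)). specialize (Hbl h ltac:(lra)). lra. }
    set (p := dx v x y) in *. set (q := dy v x y) in *.
    assert (Hkr : 0 < k * rho) by (apply Rmult_lt_0_compat; lra).
    unfold grad_norm. fold p q. rewrite <- (sqrt_pow2 (k * rho)) by lra.
    apply sqrt_le_1_alt.
    assert (Hcs : (p * n1 + q * n2) ^ 2 + (p * n2 - q * n1) ^ 2 = p ^ 2 + q ^ 2).
    { transitivity ((p ^ 2 + q ^ 2) * (n1 ^ 2 + n2 ^ 2)); [ring | rewrite Hn; ring]. }
    rewrite <- Hcs. assert (Hsq := pow2_ge_0 (p * n2 - q * n1)).
    set (z := p * n1 + q * n2) in *. nra.
  - exists (x + rho * n1), (y + rho * n2).
    assert (HB := Hray rho ltac:(lra)).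
    split; [now apply (Hdisc (x + rho * n1) (y + rho * n2)) |].
    assert (H := Hbelow _ _ (closure_incl _ _ HB)).
    replace ((x + rho * n1 - (x + rho * n1)) ^ 2 + (y + rho * n2 - (y + rho * n2)) ^ 2)
      with 0 in H by ring. lra.
Qed.

(** * The two estimates *)

(** The exponent [3] counts the factors [th] in [k rho^2]. *)
Lemma cubic_limit (A B : R) : (forall th, 0 < th < 1 -> th ^ 3 * A <= B) -> A <= B.
Proof.
  intros H. apply Rnot_lt_le. intros Hlt.
  assert (HA : 0 < A).
  { apply Rnot_le_lt. intros HA.
    assert (H1 := H (1 / 2) ltac:(lra)). lra. }
  pose (d := Rmin (1 / 2) ((A - B) / (6 * A))).
  assert (Hq : 0 < (A - B) / (6 * A)) by (apply Rdiv_lt_0_compat; lra).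
  assert (Hd : 0 < d) by (apply Rmin_glb_lt; lra).
  assert (Hd1 := Rmin_l (1 / 2) ((A - B) / (6 * A))).
  assert (Hd2 := Rmin_r (1 / 2) ((A - B) / (6 * A))). fold d in Hd1, Hd2.
  assert (HdA : d * (6 * A) <= A - B).
  { replace (A - B) with ((A - B) / (6 * A) * (6 * A)) by (field; lra).
    apply Rmult_le_compat_r; lra. }
  assert (H1 := H (1 - d) ltac:(lra)).
  assert (H2 : (1 - 3 * d) * A <= (1 - d) ^ 3 * A) by (apply Rmult_le_compat_r; nra).
  lra.
Qed.

(** By [ln (z^2) <= z^2 - 1], a rational inequality in [S] remains, with
    equality to first order at [S = 1]. *)
Lemma log_bound (mu S : R) : 0 < mu -> 1 <= S ->
  2 * ln ((1 + mu) * S / (1 + mu * S)) <= (S ^ 2 - 1) / (1 + mu).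
Proof.
  intros Hmu HS.
  assert (HmS : 0 < mu * S) by (apply Rmult_lt_0_compat; lra).
  set (z := (1 + mu) * S / (1 + mu * S)).
  assert (Hz : 0 < z).
  { apply Rdiv_lt_0_compat; [apply Rmult_lt_0_compat |]; lra. }
  assert (Hln : 2 * ln z <= z ^ 2 - 1).
  { replace (2 * ln z) with (ln (z ^ 2)) by (rewrite ln_pow by exact Hz; simpl; ring).
    assert (Hz2 : 0 < z ^ 2) by (now apply pow_lt).
    assert (H := exp_ineq1_le (ln (z ^ 2))). rewrite exp_ln in H by exact Hz2. lra. }
  apply Rle_trans with (1 := Hln).
  replace (z ^ 2 - 1) with ((S - 1) * (S + 1 + 2 * mu * S) / (1 + mu * S) ^ 2)
    by (unfold z; field; lra).
  replace ((S ^ 2 - 1) / (1 + mu)) with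
    ((S - 1) * ((S + 1) * (1 + mu * S) ^ 2 / (1 + mu)) / (1 + mu * S) ^ 2)
    by (field; lra).
  apply Rmult_le_compat_r; [apply Rlt_le, Rinv_0_lt_compat, pow_lt; lra |].
  apply Rmult_le_compat_l; [lra |].
  apply (Rmult_le_reg_r (1 + mu)); [lra |].
  replace ((S + 1) * (1 + mu * S) ^ 2 / (1 + mu) * (1 + mu))
    with ((S + 1) * (1 + mu * S) ^ 2) by (field; lra).
  pose (h := S - 1). assert (Hh : 0 <= h) by (unfold h; lra).
  replace S with (1 + h) by (unfold h; ring).
  assert (0 <= mu * h) by (apply Rmult_le_pos; lra).
  assert (0 <= mu * (mu * h)) by (apply Rmult_le_pos; lra).
  assert (0 <= h * (mu * h)) by (apply Rmult_le_pos; lra).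
  assert (0 <= (mu * h) * (mu * h)) by (apply Rmult_le_pos; lra).
  assert (0 <= mu * (h * (mu * h))) by (apply Rmult_le_pos; lra).
  assert (0 <= h * (mu * h * (mu * h))) by (apply Rmult_le_pos; lra).
  lra.
Qed.

Theorem theorem1p3 (Omega : R2 -> Prop) (mu : R) (v : R -> R -> R)
  (q_min v_min kappa_max : R)
  (HOmega : is_domain Omega) (Hbounded : is_bounded Omega)
  (Hsmooth : smooth_boundary Omega) (Hconvex : strictly_convex Omega)
  (Hmu : 0 < mu) (Hv : is_solution Omega mu v)
  (Hq_min : is_minimum
     (fun q => exists x y, boundary Omega (x, y) /\ q = grad_norm v x y) q_min)
  (Hv_min : is_minimum
     (fun z => exists x y, closure Omega (x, y) /\ z = v x y) v_min)
  (Hkappa_max : is_maximum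
     (fun k => exists p, boundary_curvature Omega p k) kappa_max) :
  q_min >= (1 + mu) / (2 * kappa_max) /\
  - v_min >=
    2 * ln (((1 + mu) * sqrt (1 + (1 + mu) ^ 2 / (4 * kappa_max ^ 2))) /
            (1 + mu * sqrt (1 + (1 + mu) ^ 2 / (4 * kappa_max ^ 2)))).
Proof.
  destruct HOmega as [Hne [Hop _]]. destruct Hconvex as [Hconv Hpos].
  destruct Hkappa_max as [[pk Hpk] Hmax].
  assert (Hkap := Hpos _ _ Hpk).
  destruct Hq_min as [[x [y [HP Hq]]] _]. destruct Hv_min as [_ Hvm].
  set (kap := kappa_max) in *.
  assert (Hest : forall th, 0 < th < 1 ->
    th ^ 2 * ((1 + mu) / (2 * kap)) <= q_min /\
    th ^ 3 * ((1 + mu) / (4 * kap ^ 2)) <= - v_min).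
  { intros th Hth.
    assert (Hrho : 0 < th / kap) by (apply Rdiv_lt_0_compat; lra).
    (* The barrier needs [k] and [rho] strictly below their critical values. *)
    destruct (barrier_estimates Omega mu (th * ((1 + mu) / 2)) (th / kap) x y v)
      as [H1 [x' [y' [HO H2]]]]; try assumption.
    - split; nra.
    - intros p c Hc. apply Rle_lt_trans with kap; [apply Hmax; now exists p |].
      replace (/ (th / kap)) with (kap / th) by (field; lra).
      apply (Rmult_lt_reg_r th); [lra |].
      replace (kap / th * th) with kap by (field; lra). nra.
    - split.
      + rewrite Hq. replace (th ^ 2 * ((1 + mu) / (2 * kap)))
          with (th * ((1 + mu) / 2) * (th / kap)) by (field; lra). exact H1.
      + assert (Hmin : v_min <= v x' y').
        { apply Hvm. exists x', y'. split; [now apply closure_incl | reflexivity]. }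
        replace (th ^ 3 * ((1 + mu) / (4 * kap ^ 2)))
          with (th * ((1 + mu) / 2) / 2 * (th / kap) ^ 2) by (field; lra). lra. }
  split; apply Rle_ge.
  - apply cubic_limit. intros th Hth. apply Rle_trans with (2 := proj1 (Hest th Hth)).
    apply Rmult_le_compat_r; [| simpl; nra].
    apply Rlt_le, Rdiv_lt_0_compat; lra.
  - apply Rle_trans with ((1 + mu) / (4 * kap ^ 2)).
    + assert (Hk2 : 0 < 4 * kap ^ 2) by nra.
      assert (HQ : 0 < (1 + mu) ^ 2 / (4 * kap ^ 2)) by (apply Rdiv_lt_0_compat; nra).
      set (Q2 := (1 + mu) ^ 2 / (4 * kap ^ 2)) in *.
      replace ((1 + mu) / (4 * kap ^ 2)) with ((sqrt (1 + Q2) ^ 2 - 1) / (1 + mu)).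
      2:{ rewrite pow2_sqrt by lra. unfold Q2. field. lra. }
      apply log_bound; [exact Hmu |]. rewrite <- sqrt_1 at 1. apply sqrt_le_1_alt. lra.
    + apply cubic_limit. intros th Hth. apply (Hest th Hth).
Qed.
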